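(* Let $A$ be a finite-dimensional $k$-algebra and $n$ a positive integer. Then $\operatorname{repdim}_n(A)<\infty$ if and only if $\operatorname{rigdim}(A)\geq n+1$. In particular, let $M$ be a generator-cogenerator in $A\text{-mod}$ with $\operatorname{rd}(M)\geq\operatorname{rigdim}(A)-1$. Then $\operatorname{gldim}\operatorname{End}_A(M)=\infty$ unless $\operatorname{End}_A(M)$ is semisimple.
   Context: $k$ is a field; algebras are finite-dimensional associative unital $k$-algebras, modules are finite-dimensional left modules. $\mathrm{D}=\operatorname{Hom}_k(-,k)$. An $A$-module $M$ is a generator-cogenerator if $A$ and $\mathrm{D}(A_A)$ lie in $\operatorname{add}(M)$ (direct summands of finite direct sums of copies of $M$). $\operatorname{domdim} E$ is the largest $t\in\mathbb{N}_0$, or $\infty$, such that in a minimal injective resolution $0\to {}_EE\to I^0\to I^1\to\cdots$ all $I^i$ with $0\leq i<t$ are projective. The rigidity dimension is $\operatorname{rigdim}(A)=\sup\{\operatorname{domdim}\operatorname{End}_A(M)\mid M$ a generator-cogenerator in $A\text{-mod}$ with $\operatorname{gldim}\operatorname{End}_A(M)<\infty\}$. The $n$-th representation dimension is $\operatorname{repdim}_n(A)=\inf\{\operatorname{gldim}\operatorname{End}_A(M)\mid M$ a generator-cogenerator in $A\text{-mod}$ with $\operatorname{domdim}\operatorname{End}_A(M)\geq n+1\}$. The rigidity degree $\operatorname{rd}(M)$ is the maximal $n\in\mathbb{N}_0$, or $\infty$, such that $\operatorname{Ext}^i_A(M,M)=0$ for all $1\leq i\leq n$. *)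

(* Defs.v *)
From HB Require Import structures.
From mathcomp Require Import all_boot all_algebra all_field.
From mathcomp Require Import boolp.

Set Implicit Arguments.
Unset Strict Implicit.
Unset Printing Implicit Defensive.

Import GRing.Theory.

Local Open Scope ring_scope.

Inductive enat := Fin of nat | Inf.

Declare Scope enat_scope.
Delimit Scope enat_scope with enat.
Bind Scope enat_scope with enat.

Definition ele (x y : enat) : bool :=
  match x, y with
  | _, Inf => true
  | Inf, Fin _ => false
  | Fin m, Fin n => (m <= n)%N
  end.

Definition elt (x y : enat) : bool := ~~ ele y x.

Notation "x <= y" := (ele x y) : enat_scope.
Notation "x < y" := (elt x y) : enat_scope.

(* x - 1, with Inf - 1 = Inf and 0 - 1 truncated to 0 *)
Definition epred (x : enat) : enat := if x is Fin n then Fin n.-1 else Inf.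

(* einf of the empty set is Inf; esup is the least upper bound, so that the
   supremum of the empty set is 0. *)
Definition einf (S : enat -> Prop) : enat :=
  match pselect (exists n, `[< S (Fin n) >]) with
  | left exS => Fin (ex_minn exS)
  | right _ => Inf
  end.

Definition esup (S : enat -> Prop) : enat :=
  einf (fun u => forall x, S x -> (x <= u)%enat).

(* A k-algebra is given here by a ring R and a (central) ring morphism
   iota : k -> R.  MathComp's algebra structures exclude the zero ring, hence
   do not apply to the endomorphism ring of an arbitrary module. *)
Section Modules.

Variables (k : fieldType) (R : pzRingType) (iota : {rmorphism k -> R}).

Definition findim (X : lmodType R) : Prop :=
  exists (n : nat) (e : 'I_n -> X),
    forall x : X, exists c : 'I_n -> k, x = \sum_(i < n) iota (c i) *: e i.

Definition surjective_fun (S T : Type) (f : S -> T) : Prop :=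
  forall y, exists x, f x = y.

Definition exact (X Y Z : lmodType R) (f : X -> Y) (g : Y -> Z) : Prop :=
  forall y, g y = 0 <-> exists x, f x = y.

Definition zero_module (X : lmodType R) : Prop := forall x : X, x = 0.

Definition projective_module (P : lmodType R) : Prop :=
  forall (X Y : lmodType R) (g : {linear X -> Y}) (f : {linear P -> Y}),
    findim X -> findim Y -> surjective_fun g ->
    exists h : {linear P -> X}, forall x, g (h x) = f x.

Definition injective_module (I : lmodType R) : Prop :=
  forall (X Y : lmodType R) (g : {linear X -> Y}) (f : {linear X -> I}),
    findim X -> findim Y -> injective g ->
    exists h : {linear Y -> I}, forall x, h (g x) = f x.

(* ... -> P 1 -> P 0 -> X -> 0 *)
Definition projective_resolution (X : lmodType R) (P : nat -> lmodType R)
    (d : forall i, {linear P i.+1 -> P i}) (eps : {linear P 0%N -> X}) : Prop :=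
  [/\ forall i, findim (P i) /\ projective_module (P i),
      surjective_fun eps,
      exact (d 0%N) eps
    & forall i, exact (d i.+1) (d i)].

Definition projdim (X : lmodType R) : enat :=
  einf (fun t => exists n, t = Fin n /\
    exists (P : nat -> lmodType R) (d : forall i, {linear P i.+1 -> P i})
      (eps : {linear P 0%N -> X}),
      projective_resolution d eps /\
      forall i, (n < i)%N -> zero_module (P i)).

Definition gldim : enat :=
  esup (fun t => exists X : lmodType R, findim X /\ t = projdim X).

(* the image of f is an essential submodule of Y *)
Definition essential_image (X Y : lmodType R) (f : {linear X -> Y}) : Prop :=
  forall U : {pred Y}, submod_closed U -> (exists2 y, y \in U & y != 0) ->
  exists2 x, f x \in U & f x != 0.

(* 0 -> X -> I 0 -> I 1 -> ... where I 0 is an injective envelope of X and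
   I (i+1) is an injective envelope of the image of I i -> I (i+1) *)
Definition minimal_injective_resolution (X : lmodType R)
    (I : nat -> lmodType R) (eta : {linear X -> I 0%N})
    (d : forall i, {linear I i -> I i.+1}) : Prop :=
  [/\ forall i, findim (I i) /\ injective_module (I i),
      injective eta,
      exact eta (d 0%N),
      forall i, exact (d i) (d i.+1)
    & essential_image eta /\ forall i, essential_image (d i)].

Definition domdim : enat :=
  esup (fun t => exists n, t = Fin n /\
    exists (I : nat -> lmodType R) (eta : {linear R^o -> I 0%N})
      (d : forall i, {linear I i -> I i.+1}),
      minimal_injective_resolution eta d /\
      forall i, (i < n)%N -> projective_module (I i)).

(* f is a coboundary of the complex Hom_R(P, Y) in degree i *)
Definition coboundary (P : nat -> lmodType R)
    (d : forall i, {linear P i.+1 -> P i}) (Y : lmodType R) (i : nat) :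
    {linear P i -> Y} -> Prop :=
  match i with
  | 0%N => fun f => forall x, f x = 0
  | j.+1 => fun f => exists g : {linear P j -> Y}, forall x, f x = g (d j x)
  end.

(* Ext^i_R(X, Y) = 0, where Ext^i_R(X, Y) is the i-th cohomology of
   Hom_R(P, Y) for P a projective resolution of X; resolutions exist and the
   choice of one does not matter *)
Definition Ext_vanishes (i : nat) (X Y : lmodType R) : Prop :=
  forall (P : nat -> lmodType R) (d : forall i, {linear P i.+1 -> P i})
    (eps : {linear P 0%N -> X}),
    projective_resolution d eps ->
    forall f : {linear P i -> Y},
      (forall x, f (d i x) = 0) -> coboundary d f.

Definition rigdeg (M : lmodType R) : enat :=
  esup (fun t => exists n, t = Fin n /\
    forall i, (1 <= i <= n)%N -> Ext_vanishes i M M).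

End Modules.

Definition semisimple_module (R : pzRingType) (X : lmodType R) : Prop :=
  forall U : {pred X}, submod_closed U ->
  exists V : {pred X}, [/\ submod_closed V,
    forall x, x \in U -> x \in V -> x = 0
  & forall x, exists u v, [/\ u \in U, v \in V & x = u + v]].

Definition semisimple_ring (R : pzRingType) : Prop := semisimple_module R^o.

(* X is a direct summand of a finite direct sum of copies of M *)
Definition in_add (R : pzRingType) (M X : lmodType R) : Prop :=
  exists (n : nat) (Y : lmodType R)
    (f : {linear (X * Y)%type -> {ffun 'I_n -> M}}), bijective f.

(* The endomorphism ring; the product is composition, (f * g) x = f (g x). *)
Definition endo (R : pzRingType) (M : lmodType R) : Type := {linear M -> M}.

Section Endo.

Variables (R : pzRingType) (M : lmodType R).

HB.instance Definition _ := gen_eqMixin (endo M).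
HB.instance Definition _ := gen_choiceMixin (endo M).

Definition endo_fun (f : endo M) : M -> M :=
  GRing.Linear.sort (f : {linear M -> M}).

Lemma endo_ext (f g : endo M) : endo_fun f =1 endo_fun g -> f = g.
Proof.
move=> /funext; case: f => f [[f1] [f2]]; case: g => g [[g1] [g2]].
rewrite /endo_fun /= => eqfg; subst g.
by congr (GRing.Linear.Pack (GRing.Linear.Class _ _)); congr (_ _);
   apply: Prop_irrelevance.
Qed.

HB.instance Definition _ (f : endo M) :=
  GRing.Linear.on (endo_fun f).

Definition endo0 : endo M := \0 : {linear M -> M}.
Definition endo_opp (f : endo M) : endo M := \- (endo_fun f) : {linear M -> M}.
Definition endo_add (f g : endo M) : endo M :=
  (endo_fun f \+ endo_fun g) : {linear M -> M}.
Definition endo1 : endo M := idfun : {linear M -> M}.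
Definition endo_mul (f g : endo M) : endo M :=
  (endo_fun f \o endo_fun g) : {linear M -> M}.

Fact endo_addA : associative endo_add.
Proof. by move=> f g h; apply: endo_ext => x /=; rewrite addrA. Qed.

Fact endo_addC : commutative endo_add.
Proof. by move=> f g; apply: endo_ext => x /=; rewrite addrC. Qed.

Fact endo_add0 : left_id endo0 endo_add.
Proof. by move=> f; apply: endo_ext => x /=; rewrite add0r. Qed.

Fact endo_addN : left_inverse endo0 endo_opp endo_add.
Proof. by move=> f; apply: endo_ext => x /=; rewrite addNr. Qed.

HB.instance Definition _ := GRing.isZmodule.Build (endo M)
  endo_addA endo_addC endo_add0 endo_addN.

Fact endo_mulA : associative endo_mul.
Proof. by move=> f g h; apply: endo_ext. Qed.

Fact endo_mul1 : left_id endo1 endo_mul.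
Proof. by move=> f; apply: endo_ext. Qed.

Fact endo_1mul : right_id endo1 endo_mul.
Proof. by move=> f; apply: endo_ext. Qed.

Fact endo_mulDl : left_distributive endo_mul endo_add.
Proof. by move=> f g h; apply: endo_ext. Qed.

Fact endo_mulDr : right_distributive endo_mul endo_add.
Proof. by move=> f g h; apply: endo_ext => x; rewrite /= raddfD. Qed.

HB.instance Definition _ := GRing.Zmodule_isPzRing.Build (endo M)
  endo_mulA endo_mul1 endo_1mul endo_mulDl endo_mulDr.

End Endo.

Section Algebra.

Variables (k : fieldType) (A : falgType k).

(* the structure morphism k -> End_A(M), c |-> (x |-> c x) *)
Section EndoAlgebra.

Variable M : lmodType A.

Definition endo_hom (c : k) (x : M) : M := c%:A *: x.

Fact endo_hom_is_linear c : linear (endo_hom c).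
Proof.
move=> a x y; rewrite /endo_hom scalerDr !scalerA.
by rewrite mulr_algl mulr_algr.
Qed.

HB.instance Definition _ c :=
  GRing.isLinear.Build A M M _ (endo_hom c) (endo_hom_is_linear c).

Definition endo_alg (c : k) : endo M := endo_hom c : {linear M -> M}.

Fact endo_alg_is_zmod_morphism : zmod_morphism endo_alg.
Proof.
by move=> c d; apply: endo_ext => x; rewrite /= /endo_hom !scalerBl.
Qed.

Fact endo_alg_is_monoid_morphism : monoid_morphism endo_alg.
Proof.
split=> [|c d]; apply: endo_ext => x; rewrite /= /endo_hom.
  by rewrite !scale1r.
by rewrite scalerA mulr_algl scalerA.
Qed.

HB.instance Definition _ :=
  GRing.isZmodMorphism.Build k (endo M) endo_alg endo_alg_is_zmod_morphism.
HB.instance Definition _ :=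
  GRing.isMonoidMorphism.Build k (endo M) endo_alg endo_alg_is_monoid_morphism.

End EndoAlgebra.

(* D(A_A) = Hom_k(A, k) as a left A-module: (a *: phi) x = phi (x * a) *)
Definition dual_regular : Type := 'Hom(A, k^o).

HB.instance Definition _ := GRing.Zmodule.on dual_regular.

Definition dual_scale (a : A) (phi : dual_regular) : dual_regular :=
  linfun (fun x : A => (phi : 'Hom(A, k^o)) (x * a)).

Fact dual_scaleE a phi (x : A) :
  (dual_scale a phi : 'Hom(A, k^o)) x = (phi : 'Hom(A, k^o)) (x * a).
Proof.
pose f (y : A) : k^o := (phi : 'Hom(A, k^o)) (y * a).
have f_lin : linear f by move=> c y z; rewrite /f mulrDl -scalerAl linearP.
pose m := GRing.isLinear.Build k A k^o _ f f_lin.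
pose g : {linear A -> k^o} := HB.pack f m.
by rewrite /dual_scale -[linfun _]/(linfun g) lfunE.
Qed.

Fact dual_scaleA a b phi :
  dual_scale a (dual_scale b phi) = dual_scale (a * b) phi.
Proof. by apply/lfunP => x; rewrite !dual_scaleE mulrA. Qed.

Fact dual_scale1 : left_id 1 dual_scale.
Proof. by move=> phi; apply/lfunP => x; rewrite dual_scaleE mulr1. Qed.

Fact dual_scaleDr : right_distributive dual_scale +%R.
Proof.
move=> a phi psi; apply/lfunP => x.
by rewrite dual_scaleE !add_lfunE !dual_scaleE.
Qed.

Fact dual_scaleDl phi : {morph dual_scale^~ phi : a b / a + b}.
Proof.
move=> a b; apply/lfunP => x.
by rewrite dual_scaleE add_lfunE !dual_scaleE mulrDr linearD.
Qed.

HB.instance Definition _ := GRing.Zmodule_isLmodule.Build A dual_regular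
  dual_scaleA dual_scale1 dual_scaleDr dual_scaleDl.

Definition gen_cogen (M : lmodType A) : Prop :=
  [/\ findim (in_alg A) M, in_add M A^o & in_add M dual_regular].

Definition rigdim : enat :=
  esup (fun t => exists M : lmodType A,
    [/\ gen_cogen M, (gldim (endo_alg M) < Inf)%enat
      & t = domdim (endo_alg M)]).

Definition repdim (n : nat) : enat :=
  einf (fun t => exists M : lmodType A,
    [/\ gen_cogen M, (Fin n.+1 <= domdim (endo_alg M))%enat
      & t = gldim (endo_alg M)]).

End Algebra.

Arguments rigdim {k} A.
Arguments repdim {k} A n.

(* Main.v *)
From HB Require Import structures.
Require Import Defs.
From mathcomp Require Import all_boot all_algebra all_field.
From mathcomp Require Import boolp classical_sets.

Set Implicit Arguments.
Unset Strict Implicit.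
Unset Printing Implicit Defensive.

Import GRing.Theory.

Local Open Scope ring_scope.

(* A projective resolution of [M] by free modules becomes, under Hom_A(-, M), a
   coresolution of End(M) by modules that are projective (since [A] is in
   add M) and injective (since [D A] is in add M).  It is exact as far as the
   self-extensions of [M] vanish, so domdim End(M) >= rd(M) + 2; projectivity
   of the terms passes to the minimal coresolution because its terms are direct
   summands.  If gldim End(M) were finite, domdim End(M) <= rigdim(A) would
   force rigdim(A) and rd(M) to be infinite, and then Schanuel's lemma, applied
   to the coresolution, makes End(M) self-injective; with finite global
   dimension all its modules are then projective, so End(M) is semisimple. *)

(** * Submodules and quotients *)

(** The equivalence is formal: a finite infimum in [enat] is attained, and a supremum that reaches
    [n + 1] has a member that does, so both sides assert a generator-cogenerator with finite global
    dimension and dominant dimension at least [n + 1]. The second part turns on a gap of one: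
    [rd(M) + 2] exceeds a finite [rigdim(A)] as soon as [rd(M)] is at least [rigdim(A) - 1]. Since
    [domdim] speaks of minimal injective resolutions, injective envelopes have to be constructed:
    splitting over the field makes Hom_k(R, X) injective, and Zorn's lemma cuts the envelope of [X]
    out of it. *)

Section LinearMaps.

Variable R : pzRingType.
Implicit Types X Y Z : lmodType R.

Definition to_linear X Y (f : X -> Y) (f_lin : linear f) : {linear X -> Y} :=
  HB.pack f (GRing.isLinear.Build R X Y _ f f_lin).

Lemma lift_along_inj X Y Z (i : {linear X -> Y}) (f : {linear Z -> Y}) :
  injective i -> (forall z, exists x, i x = f z) ->
  exists h : {linear Z -> X}, forall z, i (h z) = f z.
Proof.
move=> i_inj /choice[h hE].
have h_lin : linear h by move=> a x y; apply: i_inj;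
  rewrite linearP !hE linearP.
by exists (to_linear h_lin).
Qed.

Lemma factor_through_surj X Y Z (p : {linear X -> Y}) (f : {linear X -> Z}) :
  surjective_fun p -> (forall x, p x = 0 -> f x = 0) ->
  exists h : {linear Y -> Z}, forall x, h (p x) = f x.
Proof.
move=> /choice[s sK] kerp.
have fE x y : p x = p y -> f x = f y.
  move=> e; apply/eqP; rewrite -subr_eq0 -linearB; apply/eqP/kerp.
  by rewrite linearB e subrr.
have h_lin : linear (f \o s).
  by move=> a x y /=; rewrite -linearP; apply: fE; rewrite linearP !sK.
by exists (to_linear h_lin) => x; apply: fE; rewrite sK.
Qed.

Lemma linear_inverse X Y (f : {linear X -> Y}) :
  injective f -> surjective_fun f ->
  exists g : {linear Y -> X}, cancel f g /\ cancel g f.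
Proof.
move=> f_inj f_surj.
have [g gK] := lift_along_inj (f := idfun) f_inj f_surj.
by exists g; split=> // x; apply: f_inj; rewrite gK.
Qed.

Lemma inj_ker0 X Y (f : {linear X -> Y}) :
  (forall x, f x = 0 -> x = 0) -> injective f.
Proof.
move=> f0 x y e; apply/eqP; rewrite -subr_eq0; apply/eqP/f0.
by rewrite linearB e subrr.
Qed.

Definition submodule X (U : X -> Prop) : Prop :=
  U 0 /\ forall a x y, U x -> U y -> U (a *: x + y).

Section Submodule.

Variables (X : lmodType R) (U : X -> Prop) (Usub : submodule U).

Let U0 : U 0 := Usub.1.
Let UP a x y : U x -> U y -> U (a *: x + y). Proof. exact: Usub.2. Qed.

(** The proof that [U] is a submodule is a parameter of the type, so that the structure instances
    below are found from the type alone. *)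
Definition submod of submodule U : Type := {x : X | `[< U x >]}.
Local Notation S := (submod Usub).

HB.instance Definition _ := Choice.on S.

Let sval_inj : injective (fun x : S => sval x).
Proof. exact: val_inj. Qed.

Let in_sub (x : S) : U (sval x). Proof. exact/asboolP/(svalP x). Qed.

Definition mksub x (Ux : U x) : S := exist _ x (asboolT Ux).

Definition sub_zero : S := mksub U0.
Definition sub_add (x y : S) : S.
Proof.
apply: (@mksub (sval x + sval y)); rewrite -[sval x]scale1r.
exact: UP (in_sub x) (in_sub y).
Defined.
Definition sub_scale (a : R) (x : S) : S.
Proof.
apply: (@mksub (a *: sval x)); rewrite -[_ *: _]addr0.
exact: UP (in_sub x) U0.
Defined.
Definition sub_opp (x : S) : S.
Proof.
apply: (@mksub (- sval x)); rewrite -scaleN1r -[_ *: _]addr0.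
exact: UP (in_sub x) U0.
Defined.

Fact sub_addA : associative sub_add.
Proof. by move=> x y z; apply: sval_inj; rewrite /= addrA. Qed.
Fact sub_addC : commutative sub_add.
Proof. by move=> x y; apply: sval_inj; rewrite /= addrC. Qed.
Fact sub_add0 : left_id sub_zero sub_add.
Proof. by move=> x; apply: sval_inj; rewrite /= add0r. Qed.
Fact sub_addN : left_inverse sub_zero sub_opp sub_add.
Proof. by move=> x; apply: sval_inj; rewrite /= addNr. Qed.

HB.instance Definition _ := GRing.isZmodule.Build S
  sub_addA sub_addC sub_add0 sub_addN.

Fact sub_scaleA a b (x : S) :
  sub_scale a (sub_scale b x) = sub_scale (a * b) x.
Proof. by apply: sval_inj; rewrite /= scalerA. Qed.
Fact sub_scale1 : left_id 1 sub_scale.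
Proof. by move=> x; apply: sval_inj; rewrite /= scale1r. Qed.
Fact sub_scaleDr : right_distributive sub_scale +%R.
Proof. by move=> a x y; apply: sval_inj; rewrite /= scalerDr. Qed.
Fact sub_scaleDl (x : S) : {morph sub_scale^~ x : a b / a + b}.
Proof. by move=> a b; apply: sval_inj; rewrite /= scalerDl. Qed.

HB.instance Definition _ := GRing.Zmodule_isLmodule.Build R S
  sub_scaleA sub_scale1 sub_scaleDr sub_scaleDl.

Lemma submodule_inclusion : exists (Y : lmodType R) (i : {linear Y -> X}),
  injective i /\ forall x, U x <-> exists y, i y = x.
Proof.
have i_lin : linear (fun x : S => sval x) by [].
exists S, (to_linear i_lin); split=> [|x]; first exact: sval_inj.
by split=> [Ux | [y <-]]; [exists (mksub Ux) | apply: in_sub].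
Qed.

(** A canonical representative: [choose] depends only on the predicate, and all elements of a coset
    define the same one. The quotient is then a subtype of [X]. *)
Definition coset_rep x : X := choose (fun y => `[< U (y - x) >]) x.

Let UD x y : U x -> U y -> U (x + y).
Proof. by rewrite -{2}[x]scale1r; apply: UP. Qed.
Let UZ a x : U x -> U (a *: x).
Proof. by move=> Ux; rewrite -[_ *: _]addr0; apply: UP. Qed.
Let UN x : U x -> U (- x).
Proof. by rewrite -scaleN1r; apply: UZ. Qed.

Let coset_repP x : U (coset_rep x - x).
Proof.
apply/asboolP; rewrite /coset_rep.
by apply: (@chooseP _ (fun y => `[< U (y - x) >])); apply/asboolP;
  rewrite subrr.
Qed.

Let coset_rep_eq x y : U (x - y) -> coset_rep x = coset_rep y.
Proof.
move=> Uxy; have UE z : U (z - x) <-> U (z - y).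
  split=> [/UD/(_ Uxy) | /UD/(_ (UN Uxy))]; first by rewrite addrA subrK.
  by rewrite opprB addrA subrK.
transitivity (choose (fun z => `[< U (z - y) >]) x).
  by apply: eq_choose => z; rewrite (propext (UE z)).
by apply: choose_id; apply/asboolP; rewrite ?subrr.
Qed.

Definition quot of submodule U : Type := {x : X | coset_rep x == x}.
Local Notation Q := (quot Usub).

HB.instance Definition _ := Choice.on Q.

Definition quot_proj x : Q :=
  exist _ (coset_rep x) (introT eqP (coset_rep_eq (coset_repP x))).

Let quot_projE x y : quot_proj x = quot_proj y <-> U (x - y).
Proof.
split=> [/(congr1 val)/= e | Uxy]; last exact/val_inj/coset_rep_eq.
have := UD (UN (coset_repP x)) (coset_repP y).
by rewrite -e opprB addrA subrK.
Qed.

Let quot_projK (q : Q) : quot_proj (sval q) = q.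
Proof. by apply/val_inj/eqP/(svalP q). Qed.

Let quot_projP (x : X) : U (sval (quot_proj x) - x).
Proof. exact: coset_repP. Qed.

Definition quot_zero : Q := quot_proj 0.
Definition quot_add (x y : Q) : Q := quot_proj (sval x + sval y).
Definition quot_opp (x : Q) : Q := quot_proj (- sval x).
Definition quot_scale (a : R) (x : Q) : Q := quot_proj (a *: sval x).

Let quot_addE x y : quot_add (quot_proj x) (quot_proj y) = quot_proj (x + y).
Proof.
by apply/quot_projE; rewrite opprD addrACA; apply: UD; apply: quot_projP.
Qed.
Let quot_oppE x : quot_opp (quot_proj x) = quot_proj (- x).
Proof. by apply/quot_projE; rewrite -opprD; apply/UN/quot_projP. Qed.
Let quot_scaleE a x : quot_scale a (quot_proj x) = quot_proj (a *: x).
Proof. by apply/quot_projE; rewrite -scalerBr; apply/UZ/quot_projP. Qed.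

Fact quot_addA : associative quot_add.
Proof.
move=> x y z; rewrite -[x]quot_projK -[y]quot_projK -[z]quot_projK.
by rewrite !quot_addE addrA.
Qed.
Fact quot_addC : commutative quot_add.
Proof. by move=> x y; rewrite /quot_add addrC. Qed.
Fact quot_add0 : left_id quot_zero quot_add.
Proof. by move=> x; rewrite -[x]quot_projK quot_addE add0r. Qed.
Fact quot_addN : left_inverse quot_zero quot_opp quot_add.
Proof. by move=> x; rewrite -[x]quot_projK quot_oppE quot_addE addNr. Qed.

HB.instance Definition _ := GRing.isZmodule.Build Q
  quot_addA quot_addC quot_add0 quot_addN.

Fact quot_scaleA a b (x : Q) :
  quot_scale a (quot_scale b x) = quot_scale (a * b) x.
Proof. by rewrite -[x]quot_projK !quot_scaleE scalerA. Qed.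
Fact quot_scale1 : left_id 1 quot_scale.
Proof. by move=> x; rewrite -[x]quot_projK quot_scaleE scale1r. Qed.
Fact quot_scaleDr : right_distributive quot_scale +%R.
Proof.
move=> a x y; rewrite -[x]quot_projK -[y]quot_projK -[_ + _]/(quot_add _ _).
by rewrite quot_addE !quot_scaleE scalerDr -quot_addE.
Qed.
Fact quot_scaleDl (x : Q) : {morph quot_scale^~ x : a b / a + b}.
Proof.
by move=> a b; rewrite -[x]quot_projK !quot_scaleE scalerDl -quot_addE.
Qed.

HB.instance Definition _ := GRing.Zmodule_isLmodule.Build R Q
  quot_scaleA quot_scale1 quot_scaleDr quot_scaleDl.

Lemma submodule_quotient : exists (Y : lmodType R) (p : {linear X -> Y}),
  surjective_fun p /\ forall x, p x = 0 <-> U x.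
Proof.
have p_lin : linear (quot_proj : X -> Q).
  by move=> a x y; rewrite -quot_addE -quot_scaleE.
exists Q, (to_linear p_lin); split=> [y | x]; first by exists (sval y).
by rewrite -[0]/quot_zero -[to_linear _ x]/(quot_proj x) quot_projE subr0.
Qed.

End Submodule.

Lemma kernel_submodule X Y (f : {linear X -> Y}) :
  submodule (fun x => f x = 0).
Proof.
by split=> [|a x y fx fy]; rewrite ?linear0 // linearP fx fy scaler0 addr0.
Qed.

Lemma image_submodule X Y (f : {linear X -> Y}) :
  submodule (fun y => exists x, f x = y).
Proof.
split=> [|a _ _ [x <-] [y <-]]; first by exists 0; rewrite linear0.
by exists (a *: x + y); rewrite linearP.
Qed.

Definition short_exact X Y Z (f : {linear X -> Y}) (g : {linear Y -> Z}) : Prop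
  :=
  [/\ injective f, surjective_fun g & exact f g].

Lemma kernel_exists X Y (f : {linear X -> Y}) :
  exists (K : lmodType R) (i : {linear K -> X}), injective i /\ exact i f.
Proof.
have [K [i [i_inj iE]]] := submodule_inclusion (kernel_submodule f).
by exists K, i.
Qed.

Lemma cokernel_exists X Y (f : {linear X -> Y}) :
  exists (C : lmodType R) (p : {linear Y -> C}), surjective_fun p /\ exact f p.
Proof.
have [C [p [p_surj pE]]] := submodule_quotient (image_submodule f).
by exists C, p.
Qed.

Lemma exact_comp0 X Y Z (f : {linear X -> Y}) (g : {linear Y -> Z}) x :
  exact f g -> g (f x) = 0.
Proof. by move=> fg; apply/fg; exists x. Qed.

End LinearMaps.

(** * Finite dimension over the base field *)

Section FiniteDimension.

Variable k : fieldType.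
Implicit Types V W : lmodType k.

Definition finitely_spanned V : Prop :=
  exists (n : nat) (e : 'I_n -> V),
    forall x, exists c : 'I_n -> k, x = \sum_(i < n) c i *: e i.

Lemma combination_linear V n (e : 'I_n -> V) :
  linear (fun u : 'rV[k]_n => \sum_i u 0 i *: e i).
Proof.
move=> a u v; rewrite scaler_sumr -big_split; apply: eq_bigr => i _.
by rewrite !mxE scalerDl scalerA.
Qed.

(** A spanning family of least length is a basis: a relation with a nonzero coefficient at [i]
    expresses [e i] through the others, and dropping it leaves a shorter spanning family. *)
Lemma coordinates V : finitely_spanned V ->
  exists n (f : {linear V -> 'rV[k]_n}) (g : {linear 'rV[k]_n -> V}),
    cancel f g /\ cancel g f.
Proof.
move=> fgV; have exn : exists n, `[< exists e : 'I_n -> V,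
    forall x, exists c : 'I_n -> k, x = \sum_(i < n) c i *: e i >].
  by have [n ?] := fgV; exists n; apply/asboolP.
case: (ex_minnP exn) => n /asboolP[e eP] n_min.
pose g := to_linear (combination_linear e).
have gE u : g u = \sum_i u 0 i *: e i by [].
have g_surj : surjective_fun g.
  move=> x; have [c ->] := eP x; exists (\row_i c i).
  by rewrite gE; apply: eq_bigr => i _; rewrite mxE.
suff g_inj : injective g.
  by have [f [gK fK]] := linear_inverse g_inj g_surj; exists n, f, g.
apply: inj_ker0 => u gu0; apply/rowP => i; rewrite mxE; apply/eqP.
apply: contraT => ui0; case: n e eP n_min @g gE g_surj u gu0 i ui0.
  by move=> ? ? ? ? ? ? ? ? [].
move=> n e eP n_min g gE g_surj u gu0 i ui0.
suff : (n.+1 <= n)%N by rewrite ltnn.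
apply: n_min; apply/asboolP; exists (fun j => e (lift i j)) => x.
have [c ->] := eP x.
have ei : e i = \sum_j (- (u 0 i)^-1 * u 0 (lift i j)) *: e (lift i j).
  apply: (scalerI ui0); rewrite scaler_sumr.
  have := gu0; rewrite gE (bigD1_ord i) //= => /eqP.
  rewrite addr_eq0 => /eqP->; rewrite -sumrN; apply: eq_bigr => j _.
  by rewrite scalerA mulNr mulrN mulrA divff // mul1r scaleNr.
exists (fun j => c i * (- (u 0 i)^-1 * u 0 (lift i j)) + c (lift i j)).
rewrite (bigD1_ord i) //= {1}ei scaler_sumr -big_split; apply: eq_bigr => j _.
by rewrite /= scalerA scalerDl.
Qed.

(** A family of [V] whose image has maximal rank spans: appending [f x] cannot raise the rank, so
    [f x] is a combination of the images, and injectivity carries this back to [V]. *)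
Lemma finitely_spanned_inj V W (f : {linear V -> W}) :
  injective f -> finitely_spanned W -> finitely_spanned V.
Proof.
move=> f_inj /coordinates[n [h [h' [hK _]]]].
have hf_inj : injective (h \o f) by apply: inj_comp f_inj; apply: can_inj hK.
have exr : exists r, `[< exists m (v : 'I_m -> V),
    \rank (\matrix_i h (f (v i))) = r >].
  pose v0 (i : 'I_0) : V := 0.
  by exists (\rank (\matrix_i h (f (v0 i)))); apply/asboolP; exists 0%N, v0.
have r_le r : `[< exists m (v : 'I_m -> V),
    \rank (\matrix_i h (f (v i))) = r >] -> (r <= n)%N.
  by move=> /asboolP[m [v <-]]; apply: rank_leq_col.
case: (ex_maxnP exr r_le) => r /asboolP[m [v rE]] r_max.
exists m, v => x.
set B := \matrix_i _ in rE.
have sBx : (h (f x) <= B)%MS.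
  pose v' (i : 'I_(m + 1)) := if split i is inl j then v j else x.
  have BE : col_mx B (h (f x)) = \matrix_i h (f (v' i)).
    apply/row_matrixP => i; rewrite rowK /v' -[i in row i _]splitK.
    case: (split i) => a; rewrite ?col_mxKu /=.
      by rewrite rowKu rowK.
    by rewrite rowKd row_id.
  have : (\rank (col_mx B (h (f x))) <= r)%N.
    by apply: r_max; apply/asboolP; exists (m + 1)%N, v'; rewrite BE.
  rewrite -rE -addsmxE (geq_leqif (mxrank_leqif_sup (addsmxSl B _))).
  by rewrite addsmx_sub => /andP[].
have /submxP[c cE] := sBx; exists (fun i => c 0 i); apply: hf_inj => /=.
rewrite cE !linear_sum; apply/rowP => j; rewrite mxE summxE.
by apply: eq_bigr => i _; rewrite !linearZ !mxE.
Qed.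

(** In coordinates an injective map is a row-free matrix, with [pinvmx] as right inverse. The
    injectivity of coinduced modules and of [evalM] rests on this splitting. *)
Lemma linear_retraction V W (f : {linear V -> W}) :
  injective f -> finitely_spanned W ->
  exists r : {linear W -> V}, forall x, r (f x) = x.
Proof.
move=> f_inj fgW; have fgV := finitely_spanned_inj f_inj fgW.
have [m [h [h' [hK hK']]]] := coordinates fgV.
have [n [q [q' [qK qK']]]] := coordinates fgW.
pose F : {linear 'rV[k]_m -> 'rV[k]_n} := q \o f \o h'.
have F_free : row_free (lin1_mx F).
  apply: inj_row_free => u; rewrite mul_rV_lin1 => Fu0.
  have F_inj : injective F.
    by apply: inj_comp (can_inj hK'); apply: inj_comp f_inj; apply: can_inj qK.
  by apply: F_inj; rewrite Fu0 linear0.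
pose G : {linear 'rV[k]_n -> 'rV[k]_m} := mulmxr (pinvmx (lin1_mx F)).
exists (h' \o G \o q) => x /=.
have -> : q (f x) = F (h x) by rewrite /= hK.
by rewrite -mul_rV_lin1 mulmxKp ?hK.
Qed.

Lemma dual_basis V : finitely_spanned V ->
  exists n (e : 'I_n -> V) (l : 'I_n -> {linear V -> k^o}),
    forall x, x = \sum_i l i x *: e i.
Proof.
move=> /coordinates[n [f [g [fK gK]]]].
have l_lin i : linear (fun x => f x 0 i : k^o).
  by move=> a x y; rewrite linearP !mxE.
exists n, (fun i => g (delta_mx 0 i)), (fun i => to_linear (l_lin i)) => x.
rewrite -{1}[x]fK {1}[f x]row_sum_delta linear_sum; apply: eq_bigr => i _.
by rewrite linearZ.
Qed.

Variables (R : pzRingType) (iota : {rmorphism k -> R}).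
Implicit Types X Y Z : lmodType R.

Section Restriction.

Variable X : lmodType R.

Definition restrict of {rmorphism k -> R} : Type := X.
Local Notation X_k := (restrict iota).

HB.instance Definition _ := GRing.Zmodule.on X_k.

Definition restrict_scale (c : k) (x : X_k) : X_k := iota c *: (x : X).

Fact restrict_scaleA a b x :
  restrict_scale a (restrict_scale b x) = restrict_scale (a * b) x.
Proof. by rewrite /restrict_scale scalerA rmorphM. Qed.
Fact restrict_scale1 : left_id 1 restrict_scale.
Proof. by move=> x; rewrite /restrict_scale rmorph1 scale1r. Qed.
Fact restrict_scaleDr : right_distributive restrict_scale +%R.
Proof. by move=> a x y; rewrite /restrict_scale scalerDr. Qed.
Fact restrict_scaleDl x : {morph restrict_scale^~ x : a b / a + b}.
Proof. by move=> a b; rewrite /restrict_scale rmorphD scalerDl. Qed.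

HB.instance Definition _ := GRing.Zmodule_isLmodule.Build k X_k
  restrict_scaleA restrict_scale1 restrict_scaleDr restrict_scaleDl.

End Restriction.

Local Notation "X %:k" := (restrict X iota) (at level 2, format "X %:k").

Lemma restrict_scaleE X (c : k) (x : X%:k) : c *: x = iota c *: (x : X).
Proof. by []. Qed.

Lemma restrict_linear X Y (f : {linear X -> Y}) :
  linear (f : X%:k -> Y%:k).
Proof. by move=> a x y; rewrite !restrict_scaleE linearP. Qed.

(** [findim iota X] unfolds to [finitely_spanned] of the restriction of [X] to [k], so the result on
    vector spaces applies as it is. *)
Lemma findim_inj X Y (f : {linear X -> Y}) :
  injective f -> findim iota Y -> findim iota X.
Proof.
exact: (@finitely_spanned_inj _ _ (to_linear (@restrict_linear X Y f))).
Qed.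

Lemma findim_surj X Y (f : {linear X -> Y}) :
  surjective_fun f -> findim iota X -> findim iota Y.
Proof.
move=> f_surj [n [e eP]]; exists n, (fun i => f (e i)) => y.
have [x <-] := f_surj y; have [c ->] := eP x; exists c.
by rewrite linear_sum; apply: eq_bigr => i _; rewrite linearZ.
Qed.

Lemma findim_fintype X (I : finType) (e : I -> X) :
  (forall x, exists c : I -> k, x = \sum_i iota (c i) *: e i) -> findim iota X.
Proof.
move=> eP; exists #|I|, (fun i => e (enum_val i)) => x.
have [c ->] := eP x; exists (fun i => c (enum_val i)).
by rewrite (reindex _ (onW_bij _ (@enum_val_bij I))).
Qed.

Lemma findim_prod X Y : findim iota X -> findim iota Y ->
  findim iota (X * Y)%type.
Proof.
move=> [m [e eP]] [n [f fP]].
apply: (@findim_fintype _ ('I_m + 'I_n)%type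
  (fun s => match s with inl i => (e i, 0) | inr i => (0, f i) end)).
move=> [x y]; have [c xE] := eP x; have [d yE] := fP y.
exists (fun s => match s with inl i => c i | inr i => d i end).
rewrite big_sumType /=.
have -> : \sum_i iota (c i) *: (e i, 0) = (x, 0 : Y).
  by rewrite xE; elim/big_rec2: _ => // i u v _ ->; 
     rewrite -[_ *: _]/(_, _) scaler0 -[_ + _]/(_, _) /= addr0.
have -> : \sum_i iota (d i) *: (0, f i) = (0 : X, y).
  by rewrite yE; elim/big_rec2: _ => // i u v _ ->; 
     rewrite -[_ *: _]/(_, _) scaler0 -[_ + _]/(_, _) /= addr0.
by rewrite -[RHS]/(_, _) /= addr0 add0r.
Qed.

Lemma findim_ffun X (J : finType) : findim iota X -> findim iota {ffun J -> X}.
Proof.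
move=> [n [e eP]].
apply: (@findim_fintype _ (J * 'I_n)%type
  (fun s => [ffun j => if j == s.1 then e s.2 else 0])) => x.
have /choice[c cE] j := eP (x j).
exists (fun s => c s.1 s.2); apply/ffunP => j.
rewrite sum_ffunE -(pair_bigA _ (fun a b =>
  (iota (c a b) *: [ffun j => if j == a then e b else 0]) j)) /=.
rewrite (bigD1 j) //= [X in _ + X]big1 => [|a aj].
  by rewrite addr0 cE; apply: eq_bigr => i _; rewrite !ffunE eqxx.
by apply: big1 => i _; rewrite !ffunE eq_sym (negPf aj) scaler0.
Qed.

End FiniteDimension.

Arguments restrict_linear {k R} iota {X Y} f.

(** * Coinduced modules *)

Section HomGroup.

Variables (S : pzRingType) (N W : lmodType S).

Definition linear_maps : Type := {linear N -> W}.

Definition hom_fun (f : linear_maps) : N -> W :=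
  GRing.Linear.sort (f : {linear N -> W}).

Lemma hom_ext (f g : linear_maps) : hom_fun f =1 hom_fun g -> f = g.
Proof.
move=> /funext; case: f => f [[f1] [f2]]; case: g => g [[g1] [g2]].
rewrite /hom_fun /= => eqfg; subst g.
by congr (GRing.Linear.Pack (GRing.Linear.Class _ _)); congr (_ _);
   apply: Prop_irrelevance.
Qed.

HB.instance Definition _ := gen_eqMixin linear_maps.
HB.instance Definition _ := gen_choiceMixin linear_maps.
HB.instance Definition _ (f : linear_maps) := GRing.Linear.on (hom_fun f).

Definition hom_zero : linear_maps := \0 : {linear N -> W}.
Definition hom_opp (f : linear_maps) : linear_maps :=
  \- (hom_fun f) : {linear N -> W}.
Definition hom_add (f g : linear_maps) : linear_maps :=
  (hom_fun f \+ hom_fun g) : {linear N -> W}.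

Fact hom_addA : associative hom_add.
Proof. by move=> f g h; apply: hom_ext => x /=; rewrite addrA. Qed.
Fact hom_addC : commutative hom_add.
Proof. by move=> f g; apply: hom_ext => x /=; rewrite addrC. Qed.
Fact hom_add0 : left_id hom_zero hom_add.
Proof. by move=> f; apply: hom_ext => x /=; rewrite add0r. Qed.
Fact hom_addN : left_inverse hom_zero hom_opp hom_add.
Proof. by move=> f; apply: hom_ext => x /=; rewrite addNr. Qed.

HB.instance Definition _ := GRing.isZmodule.Build linear_maps
  hom_addA hom_addC hom_add0 hom_addN.

End HomGroup.

Section Modules.

Variables (k : fieldType) (R : pzRingType) (iota : {rmorphism k -> R}).
Hypothesis iota_central : forall c r, iota c * r = r * iota c.

Local Notation "X %:k" := (restrict X iota) (at level 2, format "X %:k").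

Section Coinduction.

Variable X : lmodType R.

(** Hom_k(R, X), with [R] acting by right multiplication on the argument: the right adjoint of
    restriction to [k]. *)
Definition coind : Type := linear_maps (R^o)%:k X%:k.

HB.instance Definition _ := GRing.Zmodule.on coind.

Definition coind_fun (f : coind) : R -> X := @hom_fun _ (R^o)%:k X%:k f.

Lemma coind_funE (f : coind) c r s :
  coind_fun f (iota c * r + s) = iota c *: coind_fun f r + coind_fun f s.
Proof. exact: (@linearP _ _ _ _ (@hom_fun _ (R^o)%:k X%:k f) c r s). Qed.

Lemma coind_funZ (f : coind) c r :
  coind_fun f (iota c * r) = iota c *: coind_fun f r.
Proof. exact: (linearZZ (@hom_fun _ (R^o)%:k X%:k f) c r). Qed.

Lemma coind_eq (f g : coind) : coind_fun f =1 coind_fun g -> f = g.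
Proof. exact: (@hom_ext _ (R^o)%:k X%:k). Qed.

Lemma coind_exists (f : R -> X) :
  (forall c r s, f (iota c * r + s) = iota c *: f r + f s) ->
  exists F : coind, coind_fun F = f.
Proof.
by move=> f_lin; exists (@to_linear _ (R^o)%:k X%:k f f_lin : coind).
Qed.

Fact coind_scale_linear a (f : coind) c r s :
  coind_fun f ((iota c * r + s) * a)
  = iota c *: coind_fun f (r * a) + coind_fun f (s * a).
Proof. by rewrite mulrDl -mulrA coind_funE. Qed.

Definition coind_scale (a : R) (f : coind) : coind :=
  @to_linear _ (R^o)%:k X%:k (fun r => coind_fun f (r * a))
    (coind_scale_linear a f).

Fact coind_scaleA a b f :
  coind_scale a (coind_scale b f) = coind_scale (a * b) f.
Proof.
by apply: coind_eq => r; rewrite /coind_fun /= /coind_fun mulrA.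
Qed.
Fact coind_scale1 : left_id 1 coind_scale.
Proof. by move=> f; apply: coind_eq => r; rewrite /coind_fun /= mulr1. Qed.
Fact coind_scaleDr : right_distributive coind_scale +%R.
Proof. by move=> a f g; apply: coind_eq. Qed.
Fact coind_scaleDl f : {morph coind_scale^~ f : a b / a + b}.
Proof.
move=> a b; apply: coind_eq => r.
change (coind_fun f (r * (a + b)) = coind_fun f (r * a) + coind_fun f (r * b)).
rewrite mulrDr -{1}[r * a]mul1r -(rmorph1 iota) coind_funE.
by rewrite rmorph1 scale1r.
Qed.

HB.instance Definition _ := GRing.Zmodule_isLmodule.Build R coind
  coind_scaleA coind_scale1 coind_scaleDr coind_scaleDl.

Lemma coind_scaleE a (f : coind) r :
  coind_fun (a *: f) r = coind_fun f (r * a).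
Proof. by []. Qed.

Lemma coind_addE (f g : coind) r :
  coind_fun (f + g) r = coind_fun f r + coind_fun g r.
Proof. by []. Qed.

(** By the adjunction, a map [f] into [coind] amounts to the [k]-linear map [y |-> f y 1], which
    extends along [g] through a [k]-linear retraction [r]. Translated back, the extension sends [z]
    to [s |-> f (r (s *: z)) 1]. *)
Lemma coind_injective : injective_module iota coind.
Proof.
move=> Y Z g f fdY fdZ g_inj.
have [r rK] := linear_retraction (f :=
  to_linear (restrict_linear iota g)) g_inj fdZ.
have h_ex z : exists F : coind, forall s,
    coind_fun F s = coind_fun (f (r (s *: z))) 1.
  have [|F FE] := coind_exists (f := fun s => coind_fun (f (r (s *: z))) 1).
    move=> c s t; rewrite scalerDl -scalerA.
    have -> : r (iota c *: (s *: z) + t *: z) = iota c *: r (s *: z) + r (t *: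
      z).
      exact: (linearP r c (s *: z : Z%:k) (t *: z)).
    rewrite linearD linearZ coind_addE coind_scaleE mul1r.
    by rewrite -[X in coind_fun _ X]mulr1 coind_funZ.
  by exists F => s; rewrite FE.
have [h hE] := choice h_ex.
have h_lin : linear h.
  move=> a x y; apply: coind_eq => s; rewrite coind_addE coind_scaleE !hE.
  by rewrite scalerDr scalerA !linearD coind_addE.
exists (to_linear h_lin) => y; apply: coind_eq => s.
rewrite hE -linearZ; move: (rK (s *: y)) => /= ->.
by rewrite linearZ coind_scaleE mul1r.
Qed.

Lemma coind_embedding : exists f : {linear X -> coind}, injective f.
Proof.
have f_ex x : exists F : coind, forall s, coind_fun F s = s *: x.
  have [|F FE] := coind_exists (f := fun s => s *: x).
    by move=> c s t; rewrite scalerDl scalerA.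
  by exists F => s; rewrite FE.
have [f fE] := choice f_ex.
have f_lin : linear f.
  move=> a x y; apply: coind_eq => s; rewrite coind_addE coind_scaleE !fE.
  by rewrite scalerDr scalerA.
exists (to_linear f_lin) => x y /(congr1 (fun F => coind_fun F 1)).
by rewrite !fE !scale1r.
Qed.

(** Evaluation at a spanning family of [R] embeds [coind] into a power of [X]. It is [k]-linear
    because [iota] is central: [iota c *: f] evaluates [f] at [r * iota c], while scalars come out
    of [f] only from the left. *)
Lemma coind_findim :
  findim iota R^o -> findim iota X -> findim iota coind.
Proof.
move=> [n [e eP]] fdX.
pose ev (f : coind%:k) : {ffun 'I_n -> X%:k} := [ffun i => coind_fun f (e i)].
have ev_lin : linear ev.
  move=> c f g; apply/ffunP => i; rewrite !ffunE coind_addE coind_scaleE.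
  by rewrite -iota_central coind_funZ.
apply: (@finitely_spanned_inj _ _ _ (to_linear ev_lin)); last first.
  exact: (@findim_ffun k k idfun X%:k).
apply: inj_ker0 => f /ffunP f0; apply: coind_eq => s.
have [c ->] := eP s; rewrite -[RHS]/0.
rewrite -[LHS]/(@hom_fun _ (R^o)%:k X%:k f (\sum_i c i *: (e i : (R^o)%:k))).
rewrite linear_sum big1 // => i _; rewrite linearZ.
have /= := f0 i; rewrite !ffunE => fe0.
by transitivity (c i *: (0 : X%:k)); [congr (_ *: _) | rewrite scaler0].
Qed.

End Coinduction.

End Modules.

(** * Projective and injective modules *)

Section ProjectiveInjective.

Variables (k : fieldType) (R : pzRingType) (iota : {rmorphism k -> R}).
Implicit Types X Y Z P Q I : lmodType R.

Local Notation fd := (findim iota).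
Local Notation projective := (projective_module iota).
Local Notation injective_mod := (injective_module iota).

Lemma short_exact_fdr X Y Z (f : {linear X -> Y}) (g : {linear Y -> Z}) :
  short_exact f g -> fd Y -> fd Z.
Proof. by case=> _ g_surj _; apply: findim_surj g_surj. Qed.

Lemma short_exact_fdl X Y Z (f : {linear X -> Y}) (g : {linear Y -> Z}) :
  short_exact f g -> fd Y -> fd X.
Proof. by case=> f_inj _ _; apply: findim_inj f_inj. Qed.

Lemma projective_retract P X (i : {linear X -> P}) (r : {linear P -> X}) :
  cancel i r -> projective P -> projective X.
Proof.
move=> iK projP Y Z g f fdY fdZ g_surj.
have [h hE] := projP _ _ g (f \o r) fdY fdZ g_surj.
by exists (h \o i) => x; rewrite /= hE /= iK.
Qed.

Lemma injective_retract I X (i : {linear X -> I}) (r : {linear I -> X}) :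
  cancel i r -> injective_mod I -> injective_mod X.
Proof.
move=> iK injI Y Z g f fdY fdZ g_inj.
have [h hE] := injI _ _ g (i \o f) fdY fdZ g_inj.
by exists (r \o h) => y; rewrite /= hE /= iK.
Qed.

Lemma projective_section X P (p : {linear X -> P}) :
  fd X -> projective P -> surjective_fun p ->
  exists s : {linear P -> X}, cancel s p.
Proof.
move=> fdX projP p_surj.
have [s sK] := projP _ _ p idfun fdX (findim_surj p_surj fdX) p_surj.
by exists s.
Qed.

Lemma injective_retraction I X (i : {linear I -> X}) :
  fd X -> injective_mod I -> injective i ->
  exists r : {linear X -> I}, cancel i r.
Proof.
move=> fdX injI i_inj.
have [r rK] := injI _ _ i idfun (findim_inj i_inj fdX) fdX i_inj.
by exists r.
Qed.

Lemma cokernel_section X Y Z (f : {linear X -> Y}) (g : {linear Y -> Z})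
    (r : {linear Y -> X}) :
  cancel f r -> short_exact f g -> exists s : {linear Z -> Y}, cancel s g.
Proof.
move=> fK [f_inj g_surj fg].
pose u : {linear Y -> Y} := idfun \- (f \o r).
have [|s sE] := factor_through_surj (f := u) g_surj.
  by move=> y /fg[x <-] /=; rewrite fK subrr.
exists s => z; have [y <-] := g_surj z.
by rewrite sE /= linearB (exact_comp0 _ fg) subr0.
Qed.

Lemma kernel_retraction X Y Z (f : {linear X -> Y}) (g : {linear Y -> Z})
    (s : {linear Z -> Y}) :
  cancel s g -> short_exact f g -> exists r : {linear Y -> X}, cancel f r.
Proof.
move=> sK [f_inj g_surj fg].
pose u : {linear Y -> Y} := idfun \- (s \o g).
have [|r rE] := lift_along_inj (f := u) f_inj.
  by move=> y; apply/fg; rewrite /= linearB sK subrr.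
exists r => x; apply: f_inj.
by rewrite rE /= (exact_comp0 _ fg) linear0 subr0.
Qed.

Definition basis_vector n (i : 'I_n) : {ffun 'I_n -> R^o} :=
  [ffun j => (j == i)%:R].

Lemma ffun_basis n (c : {ffun 'I_n -> R^o}) :
  c = \sum_i c i *: basis_vector i.
Proof.
apply/ffunP => j; rewrite sum_ffunE (bigD1 j) //= big1 => [|i ij].
  by rewrite addr0 !ffunE eqxx -[RHS]/(_ * _) mulr1.
by rewrite !ffunE eq_sym (negPf ij) scaler0.
Qed.

Lemma ffun_combination_linear X n (x : 'I_n -> X) :
  linear (fun c : {ffun 'I_n -> R^o} => \sum_i (c i : R) *: x i).
Proof.
move=> a c d; rewrite scaler_sumr -big_split; apply: eq_bigr => i _.
by rewrite !ffunE scalerDl scalerA.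
Qed.

Lemma free_projective n : projective {ffun 'I_n -> R^o}.
Proof.
move=> X Y g f fdX fdY g_surj.
have /choice[x xE] i := g_surj (f (basis_vector i)).
exists (to_linear (ffun_combination_linear x)) => c.
rewrite [in RHS](ffun_basis c) !linear_sum; apply: eq_bigr => i _.
by rewrite !linearZ xE.
Qed.

Lemma free_cover X : fd X ->
  exists n (p : {linear {ffun 'I_n -> R^o} -> X}), surjective_fun p.
Proof.
move=> [n [e eP]]; exists n, (to_linear (ffun_combination_linear e)) => x.
have [c ->] := eP x; exists [ffun i => iota (c i)].
by apply: eq_bigr => i _; rewrite ffunE.
Qed.

Lemma projective_prod P Q : projective P -> projective Q ->
  projective (P * Q)%type.
Proof.
move=> projP projQ X Y g f fdX fdY g_surj.
have fl_lin : linear (fun p => f (p, 0)).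
  by move=> a x y; rewrite -linearP; congr (f _);
    rewrite -[RHS]/(_, _) /= scaler0 addr0.
have fr_lin : linear (fun q => f (0, q)).
  by move=> a x y; rewrite -linearP; congr (f _);
    rewrite -[RHS]/(_, _) /= scaler0 addr0.
have [h hE] := projP _ _ g (to_linear fl_lin) fdX fdY g_surj.
have [h' hE'] := projQ _ _ g (to_linear fr_lin) fdX fdY g_surj.
have h_lin : linear (fun x : P * Q => h x.1 + h' x.2).
  by move=> a x y; rewrite !linearP scalerDr addrACA.
exists (to_linear h_lin) => -[x y] /=; rewrite linearD hE hE' /= -linearD.
by rewrite -[_ + _]/(_, _) /= addr0 add0r.
Qed.

Lemma injective_ffun I n : injective_mod I -> injective_mod {ffun 'I_n -> I}.
Proof.
move=> injI X Y g f fdX fdY g_inj.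
have f_lin i : linear (fun x => f x i).
  by move=> a x y; rewrite linearP !ffunE.
have /choice[h hE] i := injI _ _ g (to_linear (f_lin i)) fdX fdY g_inj.
have h_lin : linear (fun y => [ffun i => h i y]).
  by move=> a x y; apply/ffunP => i; rewrite !ffunE linearP.
by exists (to_linear h_lin) => x; apply/ffunP => i; rewrite ffunE hE.
Qed.

Lemma short_exact_coker X Y (f : {linear X -> Y}) : injective f ->
  exists (Z : lmodType R) (g : {linear Y -> Z}), short_exact f g.
Proof.
by move=> f_inj; have [Z [g [? ?]]] := cokernel_exists f; exists Z, g.
Qed.

Lemma short_exact_ker X Y (f : {linear X -> Y}) : surjective_fun f ->
  exists (Z : lmodType R) (g : {linear Z -> X}), short_exact g f.
Proof.
by move=> f_surj; have [Z [g [? ?]]] := kernel_exists f; exists Z, g.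
Qed.

Lemma submodule_sum X (U V : X -> Prop) : submodule U -> submodule V ->
  submodule (fun x => exists u v, [/\ U u, V v & x = u + v]).
Proof.
move=> [U0 UP] [V0 VP]; split; first by exists 0, 0; rewrite addr0.
move=> a _ _ [u [v [Uu Vv ->]]] [u' [v' [Uu' Vv' ->]]].
exists (a *: u + u'), (a *: v + v'); split; [exact: UP | exact: VP |].
by rewrite scalerDr addrACA.
Qed.

Definition trivial_meet X (U V : X -> Prop) : Prop :=
  forall x, U x -> V x -> x = 0.

(** Zorn's lemma above a prescribed [B], as it is applied twice: above zero it gives a maximal [C]
    avoiding the image, and above the image a maximal submodule avoiding [C]. *)
Lemma maximal_disjoint_submodule X (B V : X -> Prop) :
  submodule B -> trivial_meet B V ->
  exists U : X -> Prop, [/\ submodule U, forall x, B x -> U x, trivial_meet U V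
  & forall W, submodule W -> (forall x, U x -> W x) -> trivial_meet W V ->
      forall x, W x -> U x].
Proof.
move=> Bsub BV.
pose P (U : set X) := [/\ submodule U, trivial_meet U V
  & forall x, B x -> U x].
(* The union of the empty chain does not contain B, hence the first disjunct. *)
have [F FP F_tot|A [AP A_max]] := @Zorn_bigcup X (fun U => U = set0 \/ P U).
  have [F0|] := EM (exists U, F U /\ P U); last first.
    move=> nF; left; apply/seteqP; split=> // x [U FU Ux].
    by have [U0|PU] := FP _ FU; [rewrite U0 in Ux | case: nF; exists U].
  right; have [W [FW [[W0 WP] WV BW]]] := F0.
  split; last by move=> x Bx; exists W => //; apply: BW.
    split; first by exists W.
    move=> a x y [U1 FU1 U1x] [U2 FU2 U2y].
    have [U [FU [Ux Uy]]] : exists U, F U /\ (U x /\ U y).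
      have [le|le] := F_tot _ _ FU1 FU2.
        by exists U2; split=> //; split=> //; apply: le.
      by exists U1; split=> //; split=> //; apply: le.
    exists U => //; have [U0|[[_ UP] _ _]] := FP _ FU; last exact: UP.
    by rewrite U0 in Ux.
  move=> x [U FU Ux]; have [U0|[_ UV _]] := FP _ FU; last exact: UV.
  by rewrite U0 in Ux.
have PA : P A.
  case: AP => // A0; have PB : P B by split.
  case: (A_max B); last by right.
  by rewrite A0; split=> // /(_ 0 Bsub.1).
case: PA => A_sub AV BA; exists A; split=> // W Wsub AW WV x Wx.
apply: contrapT => nAx; apply: (A_max W); last first.
  by right; split=> // y /BA /AW.
by split=> // /(_ x Wx).
Qed.

Lemma essential_imageP X Y (f : {linear X -> Y}) :
  (forall y, y != 0 -> exists r x, r *: y = f x /\ f x != 0) ->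
  essential_image f.
Proof.
move=> f_ess U [_ Uclosed] [y Uy y0]; have [r [x [rE fx0]]] := f_ess y y0.
exists x => //; rewrite -rE -[_ *: _]addr0 -(addNr y) -scaleN1r.
by do 2!apply: (Uclosed) => //.
Qed.

(** The kernel of [h] meets the image of [f] trivially, so by essentiality it is zero. *)
Lemma essential_ext_injective X Y Z (f : {linear X -> Y}) (h : {linear Y -> Z})
  :
  essential_image f -> injective (h \o f) -> injective h.
Proof.
move=> f_ess hf_inj; apply: inj_ker0 => y hy0; apply: contrapT => /eqP y0.
have U_closed : submod_closed [pred y | h y == 0].
  split=> [|a x z]; rewrite !inE ?linear0 // => /eqP hx /eqP hz.
  by rewrite linearP hx hz scaler0 addr0.
have [|x] := f_ess _ U_closed; first by exists y; rewrite // inE hy0.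
rewrite inE => /eqP hfx0; case/negP; apply/eqP.
by rewrite (hf_inj x 0) ?linear0 //= hfx0 !linear0.
Qed.

(* With [C] maximal among the submodules of [Q] that meet the image of [X]
   trivially and [I] maximal among those containing the image of [X] and
   meeting [C] trivially, the inclusion of [I] into [Q] extends to an injection
   of [Q / C], whose image is [I] by maximality: so [I] is a summand of [Q]. *)
Lemma essential_summand X Q (f : {linear X -> Q}) :
  fd Q -> injective_mod Q -> injective f ->
  exists I (e : {linear X -> I}) (i : {linear I -> Q}) (r : {linear Q -> I}),
    [/\ cancel i r, injective e & essential_image e].
Proof.
move=> fdQ injQ f_inj.
pose X' q := exists x, f x = q; pose O (q : Q) := q = 0.
have O_sub : submodule O by split=> // a x y -> ->; rewrite /O scaler0 addr0.
have [|C [C_sub _ CX C_max]] := @maximal_disjoint_submodule Q O X' O_sub.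
  by move=> x ->.
have [|I [I_sub XI IC I_max]] :=
  @maximal_disjoint_submodule Q X' C (image_submodule f).
  by move=> x Xx Cx; apply: CX.
(* For [q] outside [C], the submodule [R q + C] is strictly larger than [C], so by maximality it
   meets the image of [f] outside zero. *)
have meetX q : ~ C q -> exists r c x, [/\ C c, r *: q + c = f x & f x != 0].
  move=> nCq.
  have L_sub : submodule (fun y => exists r, r *: q = y).
    split; first by exists 0; rewrite scale0r.
    move=> a _ _ [r <-] [s <-]; exists (a * r + s).
    by rewrite scalerDl scalerA.
  have S_sub := submodule_sum L_sub C_sub.
  apply: contrapT => nm; apply: nCq; apply: (C_max _ S_sub).
  - by move=> c Cc; exists 0, c; split=> //; [exists 0;
    rewrite scale0r | rewrite add0r].
  - move=> _ [_ [c [[r <-] Cc ->]]] [x fxE]; apply: contrapT => /eqP n0.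
    by apply: nm; exists r, c, x; rewrite fxE.
  - by exists q, 0; split; [exists 1;
    rewrite scale1r | exact: C_sub.1 | rewrite addr0].
have IB x y : I x -> I y -> I (x - y).
  by move=> Ix Iy; rewrite addrC -scaleN1r; apply: I_sub.2.
have IZ a x : I x -> I (a *: x).
  by move=> Ix; rewrite -[_ *: _]addr0; apply: I_sub.2 I_sub.1.
have CZ a x : C x -> C (a *: x).
  by move=> Cx; rewrite -[_ *: _]addr0; apply: C_sub.2 C_sub.1.
have [J [i [i_inj iE]]] := submodule_inclusion I_sub.
have iI y : I (i y) by apply/iE; exists y.
have [Q' [p [p_surj pE]]] := submodule_quotient C_sub.
have pi_inj : injective (p \o i).
  apply: inj_ker0 => y /= /pE Ciy; apply: i_inj; rewrite linear0.
  exact: IC Ciy.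
have fdQ' : fd Q' := findim_surj p_surj fdQ.
have [h hE] := injQ _ _ (p \o i) i (findim_inj i_inj fdQ) fdQ' pi_inj.
(* The image of [h] contains [I]; once it is shown to meet [C] trivially, the maximality of [I]
   encloses it in [I]. *)
have hI q : I (h (p q)).
  apply: (I_max _ (image_submodule (h \o p))); last by exists q.
    by move=> y /iE[z <-]; exists (i z); apply: hE.
  move=> _ [z <-] /= Chz; apply: contrapT => /eqP hz0.
  have nCz : ~ C z by move=> /pE pz0; rewrite pz0 linear0 eqxx in hz0.
  have [r [c [x [Cc rE /eqP fx0]]]] := meetX z nCz; apply: fx0.
  have /iE[w wE] : I (f x) by apply: XI; exists x.
  (* [f x] lies in [I], where [h \o p] is the identity, and [p] kills [c]. So [f x] is a multiple of
     an element of [C] and lies in [C] itself. *)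
  have : f x = r *: h (p z).
    have pc0 : p c = 0 by apply/pE.
    by rewrite -linearZ -[r *: p z]addr0 -pc0 -linearZ -linearD rE -wE hE.
  by move=> fxE; apply: CX; [rewrite fxE; apply: CZ | exists x].
have [|e eE] := lift_along_inj (f := f) i_inj.
  by move=> x; apply/iE/XI; exists x.
have [|r rE] := lift_along_inj (f := h \o p) i_inj.
  by move=> q; apply/iE/hI.
exists J, e, i, r; split.
- by move=> y; apply: i_inj; rewrite rE; apply: hE.
- by move=> x y exy; apply: f_inj; rewrite -!eE exy.
apply: essential_imageP => y y0.
have nCy : ~ C (i y).
  move=> Ciy; have := IC _ (iI y) Ciy; rewrite -(linear0 i) => /i_inj y0'.
  by rewrite y0' eqxx in y0.
have [a [c [x [Cc aE fx0]]]] := meetX (i y) nCy.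
(* [c] is a difference of two elements of [I], and [I] meets [C] trivially. *)
have c0 : c = 0.
  apply: IC Cc; rewrite -[c](addKr (a *: i y)) addrC aE.
  by apply: IB (IZ _ _ (iI y)); apply: XI; exists x.
exists a, x; split.
  by apply: i_inj; rewrite linearZ eE -aE c0 addr0.
by apply: contra_neq fx0 => ex0; rewrite -eE ex0 linear0.
Qed.

Hypotheses (iota_central : forall c r, iota c * r = r * iota c)
  (fdR : fd R^o).

Lemma injective_hull X : fd X ->
  exists I Y (e : {linear X -> I}) (p : {linear I -> Y}),
  [/\ fd I, injective_mod I, short_exact e p & essential_image e].
Proof.
move=> fdX; have [f f_inj] := coind_embedding iota X.
have injC := coind_injective (iota := iota) (X := X).
have fdC := coind_findim iota_central fdR fdX.
have [I [e [i [r [iK e_inj e_ess]]]]] := essential_summand fdC injC f_inj.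
have [Y [p ep]] := short_exact_coker e_inj.
exists I, Y, e, p; split=> //; last exact: injective_retract iK injC.
exact: findim_inj (can_inj iK) fdC.
Qed.

End ProjectiveInjective.

(** * Dominant dimension *)

Lemma le_einf (S : enat -> Prop) x : S x -> (einf S <= x)%enat.
Proof.
case: x => [n|] Sx; rewrite /einf; case: pselect => // [ex|[]].
  by case: ex_minnP => m _; apply; apply/asboolP.
by exists n; apply/asboolP.
Qed.

Lemma einf_attained (S : enat -> Prop) n : einf S = Fin n -> S (Fin n).
Proof.
by rewrite /einf; case: pselect => // ex; case: ex_minnP => m /asboolP ? _ [<-].
Qed.

Lemma ele_trans x y z : (x <= y)%enat -> (y <= z)%enat -> (x <= z)%enat.
Proof. by case: x y z => [m|] [n|] [p|] //=; apply: leq_trans. Qed.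

Lemma ele_esup (S : enat -> Prop) x : S x -> (x <= esup S)%enat.
Proof.
move=> Sx; case E: (esup S) => [n|]; last by case: (x).
exact: (einf_attained E).
Qed.

Lemma esup_le (S : enat -> Prop) y :
  (forall x, S x -> (x <= y)%enat) -> (esup S <= y)%enat.
Proof. exact: (@le_einf (fun u => _)). Qed.

(** The bound is a successor because the supremum of the empty set is 0: a bound by 0 yields no
    witness. If no member reaches [n + 1], then [n] is an upper bound. *)
Lemma esup_ge (S : enat -> Prop) n :
  (Fin n.+1 <= esup S)%enat -> exists2 x, S x & (Fin n.+1 <= x)%enat.
Proof.
move=> le_n; apply: contrapT => nS.
have /(ele_trans le_n) /= : (esup S <= Fin n)%enat; last by rewrite ltnn.
apply: esup_le => x Sx; apply: contrapT => /negP nle; case: nS; exists x => //.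
by case: x nle {Sx} => //= m; rewrite -ltnNge.
Qed.

Section DominantDimension.

Variables (k : fieldType) (R : pzRingType) (iota : {rmorphism k -> R}).
Implicit Types X Y Z P Q I C : lmodType R.

Local Notation fd := (findim iota).
Local Notation projective := (projective_module iota).
Local Notation injective_mod := (injective_module iota).

(** Any coresolution counts here, minimal or not, so that the sequences coming from Hom_A(-, M)
    qualify directly; [domdim_ge_minimal] passes to the minimal one. *)
Fixpoint domdim_ge (m : nat) X : Prop :=
  if m is m'.+1 then
    exists Q Y (f : {linear X -> Q}) (g : {linear Q -> Y}),
    [/\ fd Q, projective Q, injective_mod Q, short_exact f g & domdim_ge m' Y]
  else True.

(** Inside [Q], which contains [Z], the injective [C] splits off. The quotient of [Q] by [C] is
    again projective and injective and contains [Y]; its quotient by [Y] is that of [Q] by [Z], so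
    the rest of the coresolution is kept. *)
Lemma domdim_ge_quotient m C Z Y (i : {linear C -> Z}) (q : {linear Z -> Y}) :
  injective_mod C -> short_exact i q -> domdim_ge m Z -> domdim_ge m Y.
Proof.
case: m => [//|m] injC [i_inj q_surj iq].
move=> [Q [Z1 [f [g [fdQ projQ injQ [f_inj g_surj fg] ddZ1]]]]].
have fi_inj : injective (f \o i) by apply: inj_comp.
have [Q' [p fip]] := short_exact_coker fi_inj.
have [_ p_surj fipE] := fip.
have [r rK] := injective_retraction fdQ injC fi_inj.
have [s sK] := cokernel_section rK fip.
have [|u uE] := factor_through_surj (f := p \o f) q_surj.
  by move=> z /iq[c <-]; apply: (exact_comp0 c fipE).
have [|v vE] := factor_through_surj (f := g) p_surj.
  by move=> x /fipE[c <-]; apply: exact_comp0 fg.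
exists Q', Z1, u, v; split=> //.
- exact: findim_surj p_surj fdQ.
- exact: projective_retract sK projQ.
- exact: injective_retract sK injQ.
split.
- apply: inj_ker0 => y; have [z <-] := q_surj y; rewrite uE /= => /fipE[c fic].
  by apply/iq; exists c; apply: f_inj.
- by move=> z1; have [x <-] := g_surj z1; exists (p x); rewrite vE.
move=> q'; have [x <-] := p_surj q'; rewrite vE; split=> [/fg[z <-]|[y]].
  by exists (q z); rewrite uE.
have [z <-] := q_surj y; rewrite uE /= => e.
have /fipE[c cE] : p (x - f z) = 0 by rewrite linearB e subrr.
by rewrite -(subrK (f z) x) -cE linearD !(exact_comp0 _ fg) addr0.
Qed.

(** By essentiality the extension of [f] to [I] is injective, so [Q] is the direct sum of [I] and an
    injective [C]. Then [Z], the quotient of [Q] by [X], contains [C] with quotient [Y], and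
    [domdim_ge_quotient] applies. *)
Lemma domdim_ge_hull m X I Y (e : {linear X -> I}) (p : {linear I -> Y}) :
  fd I -> injective_mod I -> short_exact e p -> essential_image e ->
  domdim_ge m.+1 X -> projective I /\ domdim_ge m Y.
Proof.
move=> fdI injI ep e_ess [Q [Z [f [g [fdQ projQ injQ fg ddZ]]]]].
have [e_inj p_surj epE] := ep; have [f_inj g_surj fgE] := fg.
have [h hE] := injQ _ _ e f (findim_inj e_inj fdI) fdI e_inj.
have h_inj : injective h.
  apply: (essential_ext_injective e_ess) => x y; rewrite /= !hE; apply: f_inj.
have [r rK] := injective_retraction fdQ injI h_inj.
split; first exact: projective_retract rK projQ.
have r_surj : surjective_fun r by move=> y; exists (h y).
have [C [c cr]] := short_exact_ker r_surj; have [c_inj _ crE] := cr.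
have [c' c'K] := kernel_retraction rK cr.
have [|w wE] := factor_through_surj (f := p \o r) g_surj.
  by move=> q /fgE[x <-]; rewrite -hE /= rK; apply: exact_comp0 epE.
apply: (@domdim_ge_quotient m C Z Y (g \o c) w) => //.
  exact: injective_retract c'K injQ.
split.
- apply: inj_ker0 => x /= /fgE[y fy]; apply: c_inj; rewrite linear0 -fy.
  have := exact_comp0 x crE; rewrite -fy -hE rK => /eqP.
  by rewrite -(linear0 e) => /eqP/e_inj->; rewrite linear0 linear0.
- move=> y; have [i <-] := p_surj y; exists (g (h i)); rewrite wE /=.
  by rewrite rK.
move=> z; have [q <-] := g_surj z; rewrite wE /=.
split=> [/epE[x exq]|[y cy]].
  have /crE[y yE] : r (q - f x) = 0 by rewrite linearB -hE rK exq subrr.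
  by exists y; rewrite /= yE linearB (exact_comp0 _ fgE) subr0.
have /fgE[x fx] : g (q - c y) = 0 by rewrite linearB cy subrr.
rewrite -(subrK (c y) q) -fx linearD (exact_comp0 _ crE) addr0 -hE rK.
exact: exact_comp0 epE.
Qed.

Hypotheses (iota_central : forall c r, iota c * r = r * iota c)
  (fdR : fd R^o).

Record hull X := Hull {
  hull_mod : lmodType R; hull_coker : lmodType R;
  hull_emb : {linear X -> hull_mod};
    hull_proj : {linear hull_mod -> hull_coker};
  hull_findim : fd hull_mod;
  hull_injective : injective_mod hull_mod;
  hull_exact : short_exact hull_emb hull_proj;
  hull_essential : essential_image hull_emb }.

Lemma domdim_ge_hull_coker m X (h : hull X) : domdim_ge m.+1 X ->
  projective (hull_mod h) /\ domdim_ge m (hull_coker h).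
Proof.
by case: h => I Y e p fdI injI ep e_ess; apply: domdim_ge_hull ep e_ess.
Qed.

(** Bundling the finiteness proof makes the cosyzygy, and later the syzygy, a self-map that can be
    iterated. *)
Record fdmodule := FdModule { fd_mod :> lmodType R; fd_findim : fd fd_mod }.

Lemma hull_exists (X : fdmodule) : exists h : hull X, True.
Proof.
have [I [Y [e [p [fdI injI ep e_ess]]]]] :=
  injective_hull iota_central fdR (fd_findim X).
by exists (Hull fdI injI ep e_ess).
Qed.

Definition the_hull (X : fdmodule) : hull X := sval (cid (hull_exists X)).

Definition cosyzygy (X : fdmodule) : fdmodule :=
  FdModule (short_exact_fdr (hull_exact (the_hull X))
                            (hull_findim (the_hull X))).

Lemma domdim_ge_minimal m X : fd X -> domdim_ge m X ->
  exists (I : nat -> lmodType R) (eta : {linear X -> I 0%N})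
    (d : forall i, {linear I i -> I i.+1}),
    minimal_injective_resolution iota eta d /\
    forall i, (i < m)%N -> projective (I i).
Proof.
move=> fdX ddX.
pose K n := iter n cosyzygy (FdModule fdX).
pose H n := the_hull (K n).
pose d n : {linear hull_mod (H n) -> hull_mod (H n.+1)} :=
  hull_emb (H n.+1) \o (hull_proj (H n) : {linear _ -> K n.+1}).
exists (fun n => hull_mod (H n)), (hull_emb (H 0%N)), d; split; last first.
  have ddK j : (j <= m)%N -> domdim_ge (m - j) (K j).
    elim: j => [|j IH] lt_jm; first by rewrite subn0.
    have := IH (ltnW lt_jm); rewrite -(subnSK lt_jm).
    by move=> /(domdim_ge_hull_coker (H j))[].
  move=> i lt_im; have := ddK i (ltnW lt_im); rewrite -(subnSK lt_im).
  by move=> /(domdim_ge_hull_coker (H i))[].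
have emb_inj n : injective (hull_emb (H n)) by case: (hull_exact (H n)).
have dK n y : d n y = 0 <-> exists x, hull_emb (H n) x = y.
  have [_ _ epE] := hull_exact (H n); split=> [|[x <-]] /=.
    by rewrite -(linear0 (hull_emb (H n.+1))) => /emb_inj/epE.
  by rewrite (exact_comp0 _ epE) linear0.
have im_d n x : exists y, d n y = hull_emb (H n.+1) x.
  by have [_ p_surj _] := hull_exact (H n); have [y <-] := p_surj x; exists y.
split=> //.
- by move=> i; split; [apply: hull_findim | apply: hull_injective].
- by move=> i; exact: dK.
- move=> i y; rewrite dK; split=> [[x <-]|[x <-]];
  last by exists (hull_proj (H i) x).
  exact: im_d.
(* The image of [d i] is that of the embedding of [K i.+1], because the projection before it is
   onto. *)
split=> [|i U Usub Uy]; first exact: hull_essential.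
have [x Ux x0] := @hull_essential _ (H i.+1) U Usub Uy.
by have [y yE] := im_d i x; exists y; rewrite yE.
Qed.

Lemma domdim_geP m : domdim_ge m R^o -> (Fin m <= domdim iota)%enat.
Proof.
move=> ddR; have [I [eta [d Id]]] := domdim_ge_minimal fdR ddR.
by apply: ele_esup; exists m; split=> //; exists I, eta, d.
Qed.

End DominantDimension.

(** * Projective dimension *)

Section ProjectiveDimension.

Variables (k : fieldType) (R : pzRingType) (iota : {rmorphism k -> R}).
Implicit Types X Y Z P Q K L : lmodType R.

Local Notation fd := (findim iota).
Local Notation projective := (projective_module iota).
Local Notation injective_mod := (injective_module iota).

Fixpoint projdim_le (d : nat) X : Prop :=
  if d is d'.+1 then
    exists P K (i : {linear K -> P}) (p : {linear P -> X}),
    [/\ fd P, projective P, short_exact i p & projdim_le d' K]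
  else projective X.

(** Peeling off [P 0] leaves a resolution of the kernel of [eps], through which [d 0] factors; when
    only [P 0] is left, [eps] is an isomorphism. *)
Lemma resolution_projdim_le n X (P : nat -> lmodType R)
    (d : forall i, {linear P i.+1 -> P i}) (eps : {linear P 0%N -> X}) :
  projective_resolution iota d eps ->
  (forall i, (n < i)%N -> zero_module (P i)) -> projdim_le n X.
Proof.
elim: n X P d eps => [|n IH] X P d eps [Pproj eps_surj deps dd] P0 /=.
  have eps_inj : injective eps.
    by apply: inj_ker0 => x /deps[y <-]; rewrite (P0 1%N isT y) linear0.
  have [g [_ gK]] := linear_inverse eps_inj eps_surj.
  exact: projective_retract gK (Pproj 0%N).2.
have [K [i iE]] := short_exact_ker eps_surj.
exists (P 0%N), K, i, eps; split=> //; try by have [] := Pproj 0%N.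
have [i_inj _ i_eps] := iE.
have [|e eE] := lift_along_inj (f := d 0%N) i_inj.
  by move=> x; apply/i_eps/deps; exists x.
apply: (IH K (fun j => P j.+1) (fun j => d j.+1) e); last first.
  by move=> j lt_nj; apply: P0.
split=> [j | y | y | j]; [exact: Pproj | | | exact: dd].
  have /deps[x xE] : eps (i y) = 0 by apply/i_eps; exists y.
  by exists x; apply: i_inj; rewrite eE.
rewrite -(dd 0%N y) -eE; split=> [-> | ]; first exact: linear0.
by rewrite -(linear0 i) => /i_inj.
Qed.

Section Schanuel.

(* The comparison maps of Schanuel's lemma: [P' -> K'] being onto, the pair
   of [theta] and [phi] maps [P' * Q] onto [K * P]. *)
Variables (X Q K P K' P' : lmodType R).
Variables (i : {linear K -> Q}) (q : {linear Q -> X}).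
Variables (i' : {linear K' -> P}) (p : {linear P -> X}).
Variables (a : {linear Q -> P}) (b : {linear P -> Q}).
Hypotheses (iq : short_exact i q) (ip : short_exact i' p).
Hypotheses (aE : forall x, p (a x) = q x) (bE : forall x, q (b x) = p x).
Variable (g : {linear P' -> K'}).

Lemma schanuel_maps :
  exists (phi : {linear (P' * Q)%type -> P}) (theta : {linear (P' * Q)%type ->
    K}),
    (forall x y, phi (x, y) = a y + i' (g x)) /\
    (forall x y, i (theta (x, y)) = y - b (a y + i' (g x))).
Proof.
pose phi : {linear (P' * Q)%type -> P} := (a \o snd) \+ (i' \o g \o fst).
pose psi : {linear (P' * Q)%type -> Q} := snd \- (b \o phi).
have [i_inj _ iqE] := iq.
have [|theta tE] := lift_along_inj (f := psi) i_inj.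
  move=> [x y]; apply/iqE; rewrite /= linearB bE linearD aE.
  have [_ _ ipE] := ip.
  by rewrite (exact_comp0 _ ipE) addr0 subrr.
by exists phi, theta; split=> // x y; rewrite tE.
Qed.

End Schanuel.

Lemma projective_lift P X Y (p : {linear X -> Y}) (f : {linear P -> Y}) :
  projective P -> fd X -> surjective_fun p ->
  exists h : {linear P -> X}, forall x, p (h x) = f x.
Proof.
move=> projP fdX p_surj.
exact: projP _ _ p f fdX (findim_surj p_surj fdX) p_surj.
Qed.

Hypothesis fdR : fd R^o.

Lemma fd_free n : fd {ffun 'I_n -> R^o}.
Proof. exact: findim_ffun fdR. Qed.

(** In the base case [K] is a retract of [K' * Q]. The inductive step compares two covers of
    [K * P]: by [P' * Q] with kernel [K''], and by a free module times [P] with kernel [L]. This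
    avoids cancelling the summand [P] from a bound on [K * P]. *)
Lemma projdim_le_syzygy d X P K' Q K (i' : {linear K' -> P}) (p : {linear P ->
  X})
    (i : {linear K -> Q}) (q : {linear Q -> X}) :
  fd P -> projective P -> short_exact i' p ->
  fd Q -> projective Q -> short_exact i q ->
  projdim_le d K' -> projdim_le d K.
Proof.
elim: d X P K' Q K i' p i q => [|d IH] X P K' Q K i' p i q
  fdP projP ip fdQ projQ iq.
all: have [i'_inj p_surj ipE] := ip; have [i_inj q_surj iqE] := iq.
all: have [a aE] := projective_lift q projQ fdP p_surj.
all: have [b bE] := projective_lift p projP fdQ q_surj.
  move=> projK'.
  have [_ [theta [_ tE]]] :=
    schanuel_maps iq ip aE bE (idfun : {linear K' -> K'}).
  have [|u uE] := lift_along_inj (f := a \o i) i'_inj.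
    by move=> x; apply/ipE; rewrite /= aE (exact_comp0 _ iqE).
  (* The sign makes the argument of [b] in [theta (- u x, i x)], namely [a (i x) - i' (u x)],
     vanish. *)
  have v_lin : linear (fun x => (- u x, i x)).
    by move=> c x y; rewrite (linearP u) (linearP i) opprD -scalerN.
  apply: (@projective_retract _ _ _ _ _ (to_linear v_lin) theta).
    move=> x; apply: i_inj; rewrite /= tE /= linearN uE /=.
    by rewrite subrr linear0 subr0.
  exact: projective_prod.
move=> [P' [K'' [i'' [g [fdP' projP' igE ddK'']]]]].
have [i''_inj g_surj i''gE] := igE.
have [phi [theta [phiE tE]]] := schanuel_maps iq ip aE bE g.
have [n [c c_surj]] := free_cover (findim_inj i_inj fdQ).
have [L [l lc]] := short_exact_ker c_surj.
exists {ffun 'I_n -> R^o}, L, l, c; split=> //; first exact: fd_free.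
  exact: free_projective.
have [l_inj _ lcE] := lc.
have w_lin : linear (fun z : (P' * Q)%type => (theta z, phi z)).
  by move=> e x y; rewrite !linearP.
have w'_lin : linear (fun z : ({ffun 'I_n -> R^o} * P)%type => (c z.1, z.2)).
  by move=> e x y; rewrite linearP.
have j_lin : linear (fun z => (i'' z, 0 : Q)).
  by move=> e x y; rewrite linearP -[RHS]/(_, _) /= scaler0 addr0.
have j'_lin : linear (fun z => (l z, 0 : P)).
  by move=> e x y; rewrite linearP -[RHS]/(_, _) /= scaler0 addr0.
apply: (IH (K * P)%type (P' * Q)%type K'' ({ffun 'I_n -> R^o} * P)%type L
  (to_linear j_lin) (to_linear w_lin) (to_linear j'_lin) (to_linear w'_lin)).
- exact: findim_prod.
- exact: projective_prod.
- split=> [x y [/i''_inj] // | [x y] | [x y]] /=.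
    have /ipE[z zE] : p (y - a (i x + b y)) = 0.
      by rewrite linearB aE linearD bE (exact_comp0 _ iqE) add0r subrr.
    (* The second component is forced: [theta] subtracts [b] of the value of [phi], which is to be
       [y], and [i x] must remain. *)
    have [t tzE] := g_surj z; exists (t, i x + b y).
    have phiE' : phi (t, i x + b y) = y by rewrite phiE tzE zE addrC subrK.
    rewrite phiE'; congr (_, _); apply: i_inj; rewrite tE -phiE phiE'.
    by rewrite addrK.
  split=> [[t0 p0] | [z [<- <-]]].
    have y0 : y = 0.
      have := tE x y; rewrite t0 -phiE p0 !linear0 addr0.
      by move<-.
    have /i''gE[z <-] : g x = 0.
      by apply: i'_inj; rewrite linear0; move: p0;
        rewrite phiE y0 linear0 add0r.
    by exists z; rewrite y0.
  have phi0 : phi (i'' z, 0) = 0.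
    by rewrite phiE (exact_comp0 _ i''gE) !linear0 addr0.
  rewrite phi0; congr (_, _); apply: i_inj.
  by rewrite tE -phiE phi0 !linear0 addr0.
- by apply: findim_prod => //; apply: fd_free.
- by apply: projective_prod => //; apply: free_projective.
- split=> [x y [/l_inj] // | [x y] | [x y]] /=.
    by have [z <-] := c_surj x; exists (z, y).
  split=> [[/lcE[z <-] ->] | [z [<- <-]]]; first by exists z.
  by rewrite (exact_comp0 _ lcE).
exact: ddK''.
Qed.

(** Dimension shift: the terms of the coresolution are projective, so each cokernel has its
    predecessor as a syzygy and the bound falls by one per step, from [m + j] at the last
    cokernel. *)
Lemma domdim_ge_projdim_le m j X :
  domdim_ge iota m X -> (forall Z, fd Z -> projdim_le (m + j) Z) ->
  fd X -> projdim_le j X.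
Proof.
elim: m j X => [|m IH] j X /=; first by move=> _ pd fdX; apply: pd.
move=> [Q [Y [f [g [fdQ projQ injQ fg ddY]]]]] pd fdX.
have [|P [K [i [p [fdP projP ip pdK]]]]] :=
  IH j.+1 Y ddY _ (short_exact_fdr fg fdQ).
  by rewrite addnS.
exact: projdim_le_syzygy ip fdQ projQ fg pdK.
Qed.

Lemma gldim_projdim_le d X : gldim iota = Fin d -> fd X -> projdim_le d X.
Proof.
move=> gl fdX.
have : (projdim iota X <= Fin d)%enat.
  by rewrite -gl; apply: ele_esup; exists X.
case E: (projdim iota X) => [n|] //= le_nd.
have [_ [[<-] [P [del [eps [res P0]]]]]] := einf_attained E.
apply: (resolution_projdim_le res) => i lt_di.
exact: P0 (leq_ltn_trans le_nd lt_di).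
Qed.

(** Of the [d + 1] terms, the first embeds [R] into [Q] and the other [d] exhibit the cokernel [Y]
    as a [d]-th syzygy. Hence [Y] is projective, the sequence splits, and [R] is a summand of
    [Q]. *)
Lemma finite_gldim_selfinjective d :
  gldim iota = Fin d -> domdim_ge iota d.+1 R^o -> injective_mod R^o.
Proof.
move=> gl [Q [Y [f [g [fdQ projQ injQ fg ddY]]]]].
have fdY := short_exact_fdr fg fdQ.
have projY : projective Y.
  apply: (domdim_ge_projdim_le (j := 0) ddY) fdY => Z fdZ.
  by rewrite addn0; apply: gldim_projdim_le.
have [s sK] := projective_section fdQ projY (let: And3 _ g_surj _ :=
  fg in g_surj).
have [r rK] := kernel_retraction sK fg.
exact: injective_retract rK injQ.
Qed.

Hypothesis injR : injective_mod R^o.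

Lemma selfinjective_projective_injective P :
  fd P -> projective P -> injective_mod P.
Proof.
move=> fdP projP; have [n [p p_surj]] := free_cover fdP.
have [s sK] := projective_section (fd_free n) projP p_surj.
exact: injective_retract sK (injective_ffun injR).
Qed.

(** By induction the syzygy [K] is projective, hence injective, so its inclusion splits and [X] is a
    summand of [P]. *)
Lemma selfinjective_projdim_le d X : fd X -> projdim_le d X -> projective X.
Proof.
elim: d X => [//|d IH] X fdX [P [K [i [p [fdP projP ip pdK]]]]].
have fdK := short_exact_fdl ip fdP.
have injK := selfinjective_projective_injective fdK (IH K fdK pdK).
have [i_inj _ _] := ip.
have [r rK] := injective_retraction fdP injK i_inj.
have [s sK] := cokernel_section rK ip.
exact: projective_retract sK projP.
Qed.

End ProjectiveDimension.

(** * Semisimplicity from projectivity of all finite-dimensional modules *)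

Section Semisimple.

Variables (k : fieldType) (R : pzRingType) (iota : {rmorphism k -> R}).
Hypothesis fdR : findim iota R^o.

Lemma projective_semisimple :
  (forall X : lmodType R, findim iota X -> projective_module iota X) ->
  semisimple_ring R.
Proof.
move=> proj U Uclosed.
have U_sub : submodule (fun x : R^o => x \in U).
  by case: Uclosed => U0 UP; split=> // a x y Ux Uy; apply: UP.
have [Y [p [p_surj pE]]] := submodule_quotient U_sub.
have [s sK] := projective_section fdR (proj _ (findim_surj p_surj fdR)) p_surj.
exists (fun x : R^o => `[< exists y, s y = x >]); split.
- split=> [|a x y /asboolP[x' <-] /asboolP[y' <-]]; apply/asboolP.
    by exists 0; rewrite linear0.
  by exists (a *: x' + y'); rewrite linearP.
- move=> x /pE px0 /asboolP[y xE].
  by rewrite -xE -(sK y) xE px0 linear0.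
move=> x; exists (x - s (p x)), (s (p x)); split; last by rewrite subrK.
  by apply/pE; rewrite linearB sK subrr.
by apply/asboolP; exists (p x).
Qed.

Lemma finite_gldim_semisimple d :
  gldim iota = Fin d -> domdim_ge iota d.+1 R^o -> semisimple_ring R.
Proof.
move=> gl dd; have injR := finite_gldim_selfinjective fdR gl dd.
apply: projective_semisimple => X fdX.
exact: selfinjective_projdim_le (gldim_projdim_le gl fdX).
Qed.

End Semisimple.

(** * The functor Hom_A(-, M) *)

Lemma in_add_decomposition (R : pzRingType) (M X : lmodType R) : in_add M X ->
  exists n (i : 'I_n -> {linear X -> M}) (p : 'I_n -> {linear M -> X}),
    forall x, \sum_j p j (i j x) = x.
Proof.
move=> [n [Y [f f_bij]]]; exists n.
have [g [fK gK]] : exists g : {linear {ffun 'I_n -> M} -> (X * Y)%type},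
    cancel f g /\ cancel g f.
  apply: linear_inverse (bij_inj f_bij) _ => y.
  by have [h _ hK] := f_bij; exists (h y); rewrite hK.
have i_lin j : linear (fun x : X => f (x, 0) j).
  move=> a x y; have -> : (a *: x + y, 0) = a *: (x, 0) + (y, 0) :> X * Y.
    by rewrite -[RHS]/(_, _) /= scaler0 addr0.
  by rewrite linearP !ffunE.
have p_lin j : linear (fun m : M => (g [ffun l => if l == j then m else 0]).1).
  move=> a x y; rewrite -[RHS]/((a *: g _ + g _).1) -linearP.
  congr ((g _).1); apply/ffunP => l; rewrite !ffunE.
  by case: eqP; rewrite ?scaler0 ?addr0.
exists (fun j => to_linear (i_lin j)), (fun j => to_linear (p_lin j)) => x /=.
have fstE (I : finType) (F : I -> X * Y) : \sum_j (F j).1 = (\sum_j F j).1.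
  by rewrite (big_morph (fun z : X * Y => z.1) (id1 := 0) (op1 := +%R)).
rewrite fstE -linear_sum; transitivity (g (f (x, 0))).1; last by rewrite fK.
congr (g _).1; apply/ffunP => l; rewrite sum_ffunE (bigD1 l) //= ffunE eqxx.
by rewrite big1 ?addr0 // => j jl; rewrite ffunE eq_sym (negPf jl).
Qed.

Section HomFunctor.

Variables (k : fieldType) (A : falgType k) (M : lmodType A).
Local Notation E := (endo M).
Local Notation iota := (endo_alg M).
Local Notation in_A := (in_alg A).
Implicit Types X Y Z : lmodType A.

Lemma endo_alg_central c (e : E) : endo_alg M c * e = e * endo_alg M c.
Proof. by apply: endo_ext => x; rewrite /= /endo_hom /= linearZ. Qed.

Section HomModule.

Variable X : lmodType A.

Definition homM : Type := linear_maps X M.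

HB.instance Definition _ := GRing.Zmodule.on homM.

Definition homM_fun (f : homM) : X -> M := @hom_fun _ X M f.

HB.instance Definition _ (f : homM) := GRing.Linear.on (homM_fun f).

Definition homM_of (f : {linear X -> M}) : homM := f.

Lemma homM_eq (f g : homM) : homM_fun f =1 homM_fun g -> f = g.
Proof. exact: hom_ext. Qed.

Definition homM_scale (e : E) (f : homM) : homM :=
  (endo_fun e \o homM_fun f) : {linear X -> M}.

Fact homM_scaleA a b f : homM_scale a (homM_scale b f) = homM_scale (a * b) f.
Proof. exact: homM_eq. Qed.
Fact homM_scale1 : left_id 1 homM_scale.
Proof. by move=> f; apply: homM_eq. Qed.
Fact homM_scaleDr : right_distributive homM_scale +%R.
Proof. by move=> a f g; apply: homM_eq => x; apply: (linearD (endo_fun a)). Qed.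
Fact homM_scaleDl f : {morph homM_scale^~ f : a b / a + b}.
Proof. by move=> a b; apply: homM_eq. Qed.

HB.instance Definition _ := GRing.Zmodule_isLmodule.Build E homM
  homM_scaleA homM_scale1 homM_scaleDr homM_scaleDl.

Lemma homM_scaleE e (f : homM) x : homM_fun (e *: f) x = endo_fun e (homM_fun f
  x).
Proof. by []. Qed.

Lemma homM_addE (f g : homM) x :
  homM_fun (f + g) x = homM_fun f x + homM_fun g x.
Proof. by []. Qed.

Lemma homM_sumE (I : finType) (F : I -> homM) x :
  homM_fun (\sum_i F i) x = \sum_i homM_fun (F i) x.
Proof. exact: (big_morph (fun w : homM => homM_fun w x)). Qed.

End HomModule.

Section HomMap.

Variables (X Y : lmodType A) (f : {linear X -> Y}).

Definition homM_comp (u : homM Y) : homM X := homM_of (homM_fun u \o f).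

Fact homM_comp_linear : linear homM_comp.
Proof. by move=> a u v; apply: homM_eq. Qed.

Definition homM_map : {linear homM Y -> homM X} := to_linear homM_comp_linear.

Lemma homM_mapE u x : homM_fun (homM_map u) x = homM_fun u (f x).
Proof. by []. Qed.

End HomMap.

(** As a left End(M)-module, [M] is Hom_A(A, M) through evaluation at 1; so Hom_A(A^n, M) is a power
    of it. *)
Definition evalM : Type := M.

HB.instance Definition _ := GRing.Zmodule.on evalM.

Definition evalM_scale (e : E) (x : evalM) : evalM := endo_fun e x.

Fact evalM_scaleA a b x :
  evalM_scale a (evalM_scale b x) = evalM_scale (a * b) x.
Proof. by []. Qed.
Fact evalM_scale1 : left_id 1 evalM_scale.
Proof. by []. Qed.
Fact evalM_scaleDr : right_distributive evalM_scale +%R.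
Proof. by move=> a x y; apply: (linearD (endo_fun a)). Qed.
Fact evalM_scaleDl x : {morph evalM_scale^~ x : a b / a + b}.
Proof. by []. Qed.

HB.instance Definition _ := GRing.Zmodule_isLmodule.Build E evalM
  evalM_scaleA evalM_scale1 evalM_scaleDr evalM_scaleDl.

Lemma evalM_scaleE e (x : evalM) : e *: x = endo_fun e x.
Proof. by []. Qed.

Lemma homM_map_inj X Y (f : {linear X -> Y}) :
  surjective_fun f -> injective (homM_map f).
Proof.
move=> f_surj u v e; apply: homM_eq => y; have [x <-] := f_surj y.
by rewrite -!homM_mapE e.
Qed.

Lemma homM_map_exact X Y Z (f : {linear X -> Y}) (g : {linear Y -> Z}) :
  surjective_fun g -> exact f g -> exact (homM_map g) (homM_map f).
Proof.
move=> g_surj fg u; split=> [uf0 | [v <-]]; last first.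
  apply: homM_eq => x; rewrite !homM_mapE (exact_comp0 _ fg).
  by rewrite (linear0 (homM_fun v)).
have [|v vE] := factor_through_surj (f := homM_fun u) g_surj.
  by move=> y /fg[x <-]; apply: (congr1 (fun w => homM_fun w x) uf0).
by exists (homM_of v); apply: homM_eq => y; apply: vE.
Qed.

Lemma homM_findim X :
  findim in_A X -> findim in_A M -> findim iota (homM X).
Proof.
move=> [n [e eP]] fdM.
pose ev (f : restrict (homM X) iota) : {ffun 'I_n -> restrict M in_A} :=
  [ffun i => homM_fun f (e i)].
have ev_lin : linear ev.
  by move=> c f g; apply/ffunP => i; rewrite !ffunE.
apply: (@finitely_spanned_inj _ _ _ (to_linear ev_lin)); last first.
  exact: (@findim_ffun k k idfun (restrict M in_A)).
apply: inj_ker0 => f /ffunP f0; apply: homM_eq => x.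
have [c ->] := eP x; rewrite (linear_sum (homM_fun f)) big1 // => i _.
have fe0 : homM_fun f (e i) = 0 by have := f0 i; rewrite !ffunE.
transitivity (in_A (c i) *: homM_fun f (e i)); last by rewrite fe0 scaler0.
exact: (linearZZ (homM_fun f)).
Qed.

(** Factoring the identity of [A] through copies of [M] writes [u] as a combination of the fixed
    maps [i l \o coord j] with coefficients [u \o delta j \o p l] in End(M), a dual basis. Lifting
    these finitely many maps lifts everything. *)
Lemma homM_free_projective n : in_add M A^o ->
  projective_module iota (homM {ffun 'I_n -> A^o}).
Proof.
move=> /in_add_decomposition[m [i [p ip]]] X Y g f fdX fdY g_surj.
have coord_lin j : linear (fun c : {ffun 'I_n -> A^o} => c j).
  by move=> a c d; rewrite !ffunE.
pose coord j := to_linear (coord_lin j).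
have delta_lin (j : 'I_n) : linear (fun a : A^o => a *: basis_vector A j).
  by move=> a c d; rewrite scalerDl scalerA.
pose delta (j : 'I_n) := to_linear (delta_lin j).
have /choice[x xE] s := g_surj (f (homM_of (i s.2 \o coord s.1))).
have h_lin : linear (fun u : homM {ffun 'I_n -> A^o} => \sum_(s : 'I_n * 'I_m)
    ((homM_fun u \o delta s.1 \o p s.2 : {linear M -> M}) : E) *: x s).
  move=> a u v; rewrite scaler_sumr -big_split; apply: eq_bigr => s _ /=.
  by rewrite scalerA -scalerDl; congr (_ *: _); apply: endo_ext.
exists (to_linear h_lin) => u /=; rewrite linear_sum.
under eq_bigr do rewrite linearZ xE -linearZ.
rewrite -linear_sum; congr (f _); apply: homM_eq => c.
rewrite homM_sumE.
under eq_bigr do rewrite homM_scaleE.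
rewrite -(pair_bigA _ (fun j l => homM_fun u (p l (i l (c j)) *: basis_vector A
  j))).
rewrite [in RHS](ffun_basis c) (linear_sum (homM_fun u));
  apply: eq_bigr => j _ /=.
by rewrite -(linear_sum (homM_fun u)) -scaler_suml ip.
Qed.

Definition dual_eval (phi : dual_regular A) (a : A) : k :=
  (phi : 'Hom(A, k^o)) a.

Lemma dual_eval_scale a phi b : dual_eval (a *: phi) b = dual_eval phi (b * a).
Proof. exact: dual_scaleE. Qed.

Lemma dual_eval_add phi psi b :
  dual_eval (phi + psi) b = dual_eval phi b + dual_eval psi b.
Proof. by rewrite /dual_eval add_lfunE. Qed.

Lemma dual_eval_sum (I : finType) (F : I -> dual_regular A) b :
  dual_eval (\sum_j F j) b = \sum_j dual_eval (F j) b.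
Proof.
apply: (big_morph (fun w => dual_eval w b)) => [phi psi|].
  exact: dual_eval_add.
by rewrite /dual_eval zero_lfunE.
Qed.

Lemma dual_evalZ phi (c : k) b :
  dual_eval phi (c *: b) = c * dual_eval phi b.
Proof. exact: (linearZZ (phi : 'Hom(A, k^o))). Qed.

Lemma dual_eval_inj phi psi : dual_eval phi =1 dual_eval psi -> phi = psi.
Proof. by move=> e; apply/lfunP => b; apply: e. Qed.

Local Notation functional := {linear restrict M in_A -> k^o}.

Lemma functional_scale (q : functional) (c : k) (x : M) :
  q (c%:A *: x) = c * q x.
Proof. exact: (linearZZ q). Qed.

(** This is the isomorphism between Hom_k(M, k) and Hom_A(M, D A); evaluation at 1 recovers [q]. *)
Lemma functional_transpose (q : functional) :
  exists h : {linear M -> dual_regular A},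
    forall x a, dual_eval (h x) a = q (a *: x).
Proof.
have h_ex x : exists phi, forall a, dual_eval phi a = q (a *: x).
  have q_lin : linear (fun a : A => q (a *: x) : k^o).
    move=> c a b; rewrite scalerDl (linearD q); congr (_ + _).
    by rewrite -mulr_algl -scalerA functional_scale.
  by exists (linfun (to_linear q_lin)) => a; rewrite /dual_eval lfunE.
have [h hE] := choice h_ex.
have h_lin : linear h.
  move=> a x y; apply: dual_eval_inj => b.
  rewrite dual_eval_add dual_eval_scale !hE scalerDr scalerA.
  exact: (linearD q).
by exists (to_linear h_lin).
Qed.

(* [M] is a summand of copies of [Hom_k(Hom_A(M, D A), k)] and [Hom_A(M, D A)]
   is a summand of a free right module.  Concretely, an extension of a map into
   [M] is determined by its composites with the functionals of [M]. *)
Lemma evalM_injective : findim in_A M -> in_add M (dual_regular A) ->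
  injective_module iota evalM.
Proof.
move=> fdM /in_add_decomposition[m [i [p ip]]] X Y g f fdX fdY g_inj.
have [r rK] := @linear_retraction k (restrict X iota) (restrict Y iota)
  (to_linear (restrict_linear iota g)) g_inj fdY.
have [n [e [l el]]] := @dual_basis k (restrict M in_A) fdM.
have [h hE] := choice functional_transpose.
(* [F j] extends to [Y] the functional on [X] given by the value of [p j (f x)] at 1. It is only
   [k]-linear, as [r] is. *)
pose F j (y : Y) : k := dual_eval (p j (f (r y))) 1.
have F_lin j c y z : F j (iota c *: y + z) = c * F j y + F j z.
  rewrite /F; have -> : r (iota c *: y + z) = iota c *: r y + r z.
    exact: (linearP r c (y : restrict Y iota) z).
  rewrite linearP evalM_scaleE.
  have -> (u v : evalM) : p j (endo_fun (iota c) u + v) = c%:A *: p j u + p j v.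
    by rewrite -linearP.
  by rewrite dual_eval_add dual_eval_scale mul1r dual_evalZ.
have F_g j x : F j (g x) = dual_eval (p j (f x)) 1.
  by rewrite /F; move: (rK x) => /= ->.
pose u j (q : functional) : E := (i j \o h q : {linear M -> M}).
(* [Phi y q] is the value prescribed for [q (H y)]. For [y = g x] the sum collapses by [ip] to
   [h q (f x)] at 1, which is [q (f x)]. *)
pose Phi y q := \sum_j F j (u j q *: y).
pose H y : evalM := \sum_t (Phi y (l t))%:A *: (e t : M).
have u_sumE (I : finType) (w : I -> E) x :
    endo_fun (\sum_t w t) x = \sum_t endo_fun (w t) x.
  exact: (big_morph (fun v : E => endo_fun v x)).
(* In the dual basis [q] is the combination of the [l t] with coefficients [q (e t)], and
   transposition is [k]-linear in [q]. *)
have hE' (q : functional) x : h q x = \sum_t ((q (e t))%:A : A) *: (h (l t) x :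
  dual_regular A).
  apply: dual_eval_inj => a; rewrite dual_eval_sum hE {1}[a *: x]el.
  rewrite (linear_sum q); apply: eq_bigr => t _.
  rewrite dual_eval_scale mulr_algr dual_evalZ hE mulrC.
  exact: (functional_scale q).
have uE j q : u j q = \sum_t iota (q (e t)) * u j (l t).
  apply: endo_ext => x; rewrite u_sumE /= hE' linear_sum.
  by apply: eq_bigr => t _; rewrite linearZ.
have F_sum j (I : finType) (c : I -> k) (y : I -> Y) :
    F j (\sum_t iota (c t) *: y t) = \sum_t c t * F j (y t).
  have F0 : F j 0 = 0.
    by have := F_lin j (-1) 0 0; rewrite scaler0 addr0 mulN1r addNr.
  by elim/big_rec2: _ => [//|t z b _ <-]; rewrite F_lin.
have HE y (q : functional) : q (H y) = Phi y q.
  transitivity (\sum_t Phi y (l t) * q (e t)).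
    by rewrite (linear_sum q); apply: eq_bigr => t _; apply: functional_scale.
  rewrite /Phi; under eq_bigr do rewrite mulr_suml.
  rewrite exchange_big; apply: eq_bigr => j _ /=.
  rewrite uE scaler_suml; under [in RHS]eq_bigr do rewrite -scalerA.
  by rewrite F_sum; apply: eq_bigr => t _; rewrite mulrC.
have M_sep (x y : M) : (forall q : functional, q x = q y) -> x = y.
  move=> qxy; rewrite [x in LHS]el [y in RHS]el.
  by apply: eq_bigr => t _; rewrite qxy.
have H_lin : linear H.
  move=> a y z; apply: M_sep => q.
  have qa_lin : linear (fun x : restrict M in_A => q (endo_fun a x)).
    move=> c x x'; rewrite -linearP; congr (q _); exact: (linearP (endo_fun a)).
  rewrite HE; transitivity (to_linear qa_lin (H y) + q (H z)); last first.
    by rewrite -(linearD q).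
  rewrite !HE -big_split; apply: eq_bigr => j _ /=.
  rewrite scalerDr scalerA.
  (* Transposition is natural: [h q] after [a] is the transpose of the functional [q \o a]. This
     turns [k]-linear data into an End(M)-linear [H]. *)
  have -> : u j q * a = u j (to_linear qa_lin).
    apply: endo_ext => x /=; congr (i j _); apply: dual_eval_inj => b.
    by rewrite !hE /= linearZ.
  by have := F_lin j 1 (u j (to_linear qa_lin) *: y) (u j q *: z);
     rewrite rmorph1 scale1r mul1r.
exists (to_linear H_lin) => x; apply: M_sep => q; rewrite [LHS]HE.
transitivity (\sum_j dual_eval (p j (i j (h q (f x)))) 1).
  by apply: eq_bigr => j _; rewrite -linearZ F_g linearZ.
by rewrite -dual_eval_sum ip hE scale1r.
Qed.

Lemma homM_free_injective n : findim in_A M -> in_add M (dual_regular A) ->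
  injective_module iota (homM {ffun 'I_n -> A^o}).
Proof.
move=> fdM coM X Y g f fdX fdY g_inj.
have ev_lin (j : 'I_n) :
    linear (fun x : X => homM_fun (f x) (basis_vector A j) : evalM).
  by move=> a x y; rewrite linearP.
have /choice[h hE] (j : 'I_n) :=
  evalM_injective fdM coM (to_linear (ev_lin j)) fdX fdY g_inj.
pose H y : homM {ffun 'I_n -> A^o} :=
  homM_of (to_linear (ffun_combination_linear (fun j => h j y : M))).
have H_lin : linear H.
  move=> a y z; apply: homM_eq => c.
  rewrite homM_addE homM_scaleE /=.
  rewrite (linear_sum (endo_fun a)) -big_split; apply: eq_bigr => j _.
  rewrite linearP scalerDr; congr (_ + _).
  exact/esym/(linearZZ (endo_fun a)).
exists (to_linear H_lin) => x; apply: homM_eq => c.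
rewrite [in RHS](ffun_basis c) (linear_sum (homM_fun (f x))).
by apply: eq_bigr => j _; rewrite (linearZZ (homM_fun (f x))) hE.
Qed.

End HomFunctor.

(** * Rigidity and dominant dimension *)

Lemma domdim_ge_iso (k : fieldType) (R : pzRingType) (iota : {rmorphism k -> R})
    m (X Y : lmodType R) (f : {linear Y -> X}) :
  injective f -> surjective_fun f -> domdim_ge iota m X -> domdim_ge iota m Y.
Proof.
case: m => // m f_inj f_surj [Q [Z [e [p [fdQ projQ injQ [e_inj p_surj ep]
  ddZ]]]]].
exists Q, Z, (e \o f), p; split=> //; split=> //; first exact: inj_comp.
move=> q; rewrite ep; split=> [[x <-] | [y <-]]; last by exists (f y).
by have [y <-] := f_surj x; exists y.
Qed.

Lemma domdim_ge_pred (k : fieldType) (R : pzRingType)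
    (iota : {rmorphism k -> R}) m (X : lmodType R) :
  domdim_ge iota m.+1 X -> domdim_ge iota m X.
Proof.
elim: m X => // m IH X [Q [Y [f [g [fdQ projQ injQ fg ddY]]]]].
by exists Q, Y, f, g; split=> //; apply: IH.
Qed.

Section Rigidity.

Variables (k : fieldType) (A : falgType k).
Local Notation in_A := (in_alg A).
Local Notation free n := {ffun 'I_n -> A^o}.

Lemma regular_findim : findim in_A A^o.
Proof.
exists (\dim {:A}), (fun i => (vbasis {:A})`_i) => x.
exists (fun i => coord (vbasis {:A}) i x).
rewrite {1}(coord_vbasis (memvf x)); apply: eq_bigr => i _.
by rewrite -[RHS]/(_ * _) mulr_algl.
Qed.

Record cover (X : lmodType A) := Cover {
  cover_rank : nat; cover_ker : lmodType A;
  cover_incl : {linear cover_ker -> free cover_rank};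
  cover_proj : {linear free cover_rank -> X};
  cover_exact : short_exact cover_incl cover_proj }.

Lemma cover_exists (X : fdmodule in_A) : exists c : cover X, True.
Proof.
have [n [p p_surj]] := free_cover (fd_findim X).
by have [K [i ip]] := short_exact_ker p_surj; exists (Cover ip).
Qed.

Definition the_cover (X : fdmodule in_A) : cover X :=
  sval (cid (cover_exists X)).

Definition syzygy (X : fdmodule in_A) : fdmodule in_A :=
  FdModule (short_exact_fdl (cover_exact (the_cover X))
                            (fd_free regular_findim (cover_rank (the_cover
                              X)))).

Variable M : lmodType A.
Hypothesis Mgc : gen_cogen M.
Local Notation iota := (endo_alg M).

Let fdM : findim in_A M. Proof. by case: Mgc. Qed.

Lemma homM_free_findim n : findim iota (homM M (free n)).
Proof. exact: homM_findim (fd_free regular_findim n) fdM. Qed.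

Lemma homM_projective n : projective_module iota (homM M (free n)).
Proof. by apply: homM_free_projective; case: Mgc. Qed.

Lemma homM_injective n : injective_module iota (homM M (free n)).
Proof. by apply: homM_free_injective; case: Mgc. Qed.

(** Left exactness turns a free presentation of [X] into two terms of a coresolution: the cokernel
    after the first embeds into the second. This is the origin of the 2 in [rd(M) + 2]. *)
Lemma homM_domdim_ge2 (X : lmodType A) : findim in_A X ->
  domdim_ge iota 2 (homM M X).
Proof.
move=> fdX; have [n [p p_surj]] := free_cover fdX.
have [K [i ip]] := short_exact_ker p_surj; have [i_inj _ ipE] := ip.
have fdK := short_exact_fdl ip (fd_free regular_findim n).
have [n' [p' p'_surj]] := free_cover fdK.
have [Z [g pg]] := short_exact_coker (homM_map_inj (M := M) p_surj).
have [_ g_surj pgE] := pg.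
have ip'E : exact (i \o p') p.
  move=> y; rewrite ipE; split=> [[x <-] | [x <-]]; last by exists (p' x).
  by have [z <-] := p'_surj x; exists z.
have e := homM_map_exact (M := M) p_surj ip'E.
have [|w wE] := factor_through_surj (f := homM_map M (i \o p')) g_surj.
  by move=> u /pgE/e.
have w_inj : injective w.
  apply: inj_ker0 => z; have [u <-] := g_surj z.
  by rewrite wE => /e/pgE.
have [Z' [g' wg']] := short_exact_coker w_inj.
exists (homM M (free n)), Z, (homM_map M p), g; split=> //.
- exact: homM_free_findim.
- exact: homM_projective.
- exact: homM_injective.
exists (homM M (free n')), Z', w, g'; split=> //.
- exact: homM_free_findim.
- exact: homM_projective.
- exact: homM_injective.
Qed.

Lemma rigid_domdim_ge m :
  (forall i, (1 <= i <= m)%N -> Ext_vanishes in_A i M M) ->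
  domdim_ge iota m.+2 (homM M M).
Proof.
move=> extM.
pose K j := iter j syzygy (FdModule fdM).
pose C j := the_cover (K j).
pose P j : lmodType A := free (cover_rank (C j)).
pose d j : {linear P j.+1 -> P j} :=
  (cover_incl (C j) : {linear K j.+1 -> P j}) \o cover_proj (C j.+1).
have res : projective_resolution in_A d (cover_proj (C 0%N)).
  have incl_inj j : injective (cover_incl (C j)) by case: (cover_exact (C j)).
  have dE j : exact (d j) (cover_proj (C j)).
    have [_ _ cE] := cover_exact (C j); move=> y; rewrite cE.
    have [_ p_surj _] := cover_exact (C j.+1).
    split=> [[x <-] | [x <-]]; last by exists (cover_proj (C j.+1) x).
    by have [z <-] := p_surj x; exists z.
  split=> [j | | | j y]; [ | by case: (cover_exact (C 0%N)) | exact: dE | ].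
    by split; [exact: (fd_free regular_findim) | apply: free_projective].
  rewrite -dE; split=> /= [|->]; last exact: linear0.
  by rewrite -(linear0 (cover_incl (C j))) => /incl_inj.
(* After [j] exact steps the module is Hom_A(K j, M), with [t] Ext conditions left to use; the two
   extra terms come at the end from [homM_domdim_ge2]. *)
suff ddK t j : (t + j = m)%N -> domdim_ge iota t.+2 (homM M (K j)).
  by apply: (ddK m 0%N); rewrite addn0.
elim: t j => [|t IH] j tj; first exact: homM_domdim_ge2 (fd_findim (K j)).
have [i_inj p_surj ipE] := cover_exact (C j).
exists (homM M (P j)), (homM M (K j.+1)), (homM_map M (cover_proj (C j))),
  (homM_map M (cover_incl (C j))); split.
- exact: homM_free_findim.
- exact: homM_projective.
- exact: homM_injective.
- split; [exact: homM_map_inj | move=> f | exact: homM_map_exact].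
  have [_ pj_surj ipjE] := cover_exact (C j.+1).
  (* Composed with the cover of [K j.+1], [f] is a cocycle of degree [j + 1]. That it is a
     coboundary means that [f] extends to [P j], so restriction along the inclusion is onto. *)
  have [||g gE] := extM j.+1 _ P d _ res (homM_fun f \o cover_proj (C j.+1)).
  + by rewrite /= -tj addSn ltnS leq_addl.
  + move=> x /=; rewrite (exact_comp0 _ ipjE).
    exact: (linear0 (homM_fun f)).
  exists (homM_of g); apply: homM_eq => y; have [x <-] := pj_surj y.
  by rewrite homM_mapE; have := gE x => /= ->.
by apply: IH; rewrite addnS -addSn.
Qed.

Lemma endo_homM_linear : linear (fun f : (endo M)^o => homM_of (endo_fun f)).
Proof. by move=> a f g; apply: homM_eq. Qed.

Let endo_homM := to_linear endo_homM_linear.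

Let endo_homM_inj : injective endo_homM.
Proof.
by move=> f g e; apply: endo_ext => x;
  apply: (congr1 (fun u => homM_fun u x) e).
Qed.

Lemma endo_findim : findim iota (endo M)^o.
Proof. exact: findim_inj endo_homM_inj (homM_findim fdM fdM). Qed.

(* One inequality of Mueller's theorem domdim End(M) = rd(M) + 2. *)
Lemma rigdeg_domdim_ge m :
  (Fin m <= rigdeg in_A M)%enat -> domdim_ge iota m.+2 (endo M)^o.
Proof.
move=> le_m; have extM i : (1 <= i <= m)%N -> Ext_vanishes in_A i M M.
  (* For [m = 0] no degree has to be checked, and only a successor bound gives a witness. *)
  case: m le_m => [|m] le_m; first by case: i.
  have [t [n [-> ext_n]] /= le_mn] := esup_ge le_m.
  by case/andP=> i_gt0 le_im; apply: ext_n; rewrite i_gt0 (leq_trans le_im).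
apply: domdim_ge_iso endo_homM_inj _ (rigid_domdim_ge extM) => f.
by exists (homM_fun f : {linear M -> M}); apply: homM_eq.
Qed.

End Rigidity.

Theorem proposition2p7 (k : fieldType) (A : falgType k) :
  (forall n : nat, (0 < n)%N ->
     (repdim A n < Inf)%enat <-> (Fin n.+1 <= rigdim A)%enat) /\
  (forall M : lmodType A,
     gen_cogen M ->
     (epred (rigdim A) <= rigdeg (in_alg A) M)%enat ->
     ~ semisimple_ring (endo M) ->
     gldim (endo_alg M) = Inf).
Proof.
split=> [n n_gt0 | M Mgc le_rd nss].
  split=> [|/esup_ge[_ [M [Mgc gl_fin ->] dd_n]]].
    case E: (repdim A n) => [d|] // _.
    have [M [Mgc dd_n gl]] := einf_attained E; apply: ele_trans dd_n _.
    by apply: ele_esup; exists M; rewrite -gl.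
  have : (repdim A n <= gldim (endo_alg M))%enat by apply: le_einf; exists M.
  by case: (gldim _) gl_fin; case: (repdim A n).
case gl: (gldim _) => [d|] //; case: nss.
have fdE := endo_findim Mgc.
have dd_le m : (Fin m <= domdim (endo_alg M))%enat -> (Fin m <= rigdim A)%enat.
  by move/ele_trans; apply; apply: ele_esup; exists M; rewrite gl.
case rig: (rigdim A) le_rd => [r|] /= le_rd; last first.
  (* Infinite rigidity degree gives every length; [d + 1] in degree yields [d + 3] terms, two more
     than required. *)
  apply: (finite_gldim_semisimple fdE gl); do 2!apply: domdim_ge_pred.
  by apply: (rigdeg_domdim_ge Mgc (m := d.+1)); case: (rigdeg _ _) le_rd.
(* A dominant dimension above [r = rigdim A] is absurd, as [M] is among the modules over which the
   supremum is taken. *)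
suff : (Fin r.+1 <= domdim (endo_alg M))%enat.
  by move/dd_le; rewrite rig /= ltnn.
apply: (domdim_geP (@endo_alg_central _ _ M) fdE).
case: r {rig} le_rd => [|r] le_rd.
  (* The predecessor of 0 is truncated, so only [rd(M) >= 0] is known; this still gives two terms
     where one suffices. *)
  by apply: domdim_ge_pred; apply: (rigdeg_domdim_ge Mgc).
exact: (rigdeg_domdim_ge Mgc).
Qed.
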